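(* Let $(G,H)$ be a discrete Hecke pair, let $\nu$ be a nondegenerate $*$-representation of $c_0(G/H)$ on a Hilbert space $\mathcal{K}$, and let $V$ be a unital $*$-representation of the Hecke algebra $\mathcal{H}(G,H)$ on the same Hilbert space $\mathcal{K}$. Then: (i) $(\nu,V)$ is a matrix unit pair if and only if there exist a Hilbert space $\mathcal{K}_0$ and a (unital $*$-)representation $\tilde V$ of $\mathcal{H}(G,H)$ on $\mathcal{K}_0\otimes\ell^2(G/H)$ such that $(\nu,V)$ is unitarily equivalent to $(1\otimes M,\tilde V)$ and such that $$(1\otimes M(\epsilon_{xH}))\,\tilde V([Hx^{-1}yH])\,(1\otimes M(\epsilon_{yH})) = 1\otimes\bigl(M(\epsilon_{xH})\rho([Hx^{-1}yH])M(\epsilon_{yH})\bigr)\quad\text{for all }x,y\in G.$$ (ii) $(\nu,V)$ is a covariant pair if and only if there exists a Hilbert space $\mathcal{K}_0$ such that $(\nu,V)$ is unitarily equivalent to $(1\otimes M,1\otimes\rho)$ on $\mathcal{K}_0\otimes\ell^2(G/H)$. In particular, a representation $\nu$ of $c_0(G/H)$ is unitarily equivalent to a multiple of $M$ (that is, to $1\otimes M$ on $\mathcal{K}_0\otimes\ell^2(G/H)$ for some Hilbert space $\mathcal{K}_0$) if and only if there exists a representation $V$ of $\mathcal{H}(G,H)$ on the same space such that $(\nu,V)$ is a covariant pair.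
   Context: A discrete Hecke pair $(G,H)$ is a discrete group $G$ with a subgroup $H$ such that every double coset $HxH$ contains only finitely many left cosets of $H$. The Hecke algebra $\mathcal{H}(G,H)$ is the $*$-algebra of finitely supported complex functions on $H\backslash G/H$ with $fg(HxH)=\sum_{yH\in G/H} f(HyH)g(Hy^{-1}xH)$ and $f^*(HxH)=\overline{f(Hx^{-1}H)}$. $[HxH]\in\mathcal{H}(G,H)$ denotes the characteristic function of the double coset $HxH$, and $\epsilon_{xH}$ denotes the characteristic function of the point $xH$ of $G/H$, viewed in $c_0(G/H)$ or in $\ell^2(G/H)$. Representations of $C^*$-algebras are nondegenerate $*$-homomorphisms into bounded operators on a Hilbert space; representations of Hecke algebras are unital $*$-representations by bounded operators. Let $\nu$ be a nondegenerate $*$-representation of $c_0(G/H)$ and $V$ a unital $*$-representation of $\mathcal{H}(G,H)$ on the same Hilbert space $\mathcal{K}$. The pair $(\nu,V)$ is a matrix unit pair if the operators $\upsilon_{xH,yH}=\nu(\epsilon_{xH})V([Hx^{-1}yH])\nu(\epsilon_{yH})$, $xH,yH\in G/H$, form a set of matrix units in $B(\mathcal{K})$, i.e. $\upsilon_{xH,yH}^*=\upsilon_{yH,xH}$, $\upsilon_{xH,yH}\upsilon_{yH,zH}=\upsilon_{xH,zH}$, and $\upsilon_{xH,yH}\upsilon_{wH,zH}=0$ if $yH\neq wH$. The pair $(\nu,V)$ is a covariant pair if for all $a,x,b\in G$ $$V([HaH])\nu(\epsilon_{xH})V([HbH])=\sum_{uH\subseteq Ha^{-1}H,\ vH\subseteq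 HbH}\nu(\epsilon_{xuH})V([Hu^{-1}vH])\nu(\epsilon_{xvH}),$$ the sum being over left cosets $uH$ contained in $Ha^{-1}H$ and left cosets $vH$ contained in $HbH$. $M$ is the representation of $c_0(G/H)$ on $\ell^2(G/H)$ by pointwise multiplication, and $\rho$ is the representation of $\mathcal{H}(G,H)$ on $\ell^2(G/H)$ given by $\rho([HaH])\epsilon_{yH}=\sum_{uH\subseteq Ha^{-1}H}\epsilon_{yuH}$. Unitary equivalence of pairs means that a single unitary intertwines both components. *)

(* Defs.v *)
From HB Require Import structures.
From mathcomp Require Import all_boot all_order all_algebra.
From mathcomp Require Import sesquilinear complex finmap.
From mathcomp Require Import ring.
From mathcomp Require Import all_classical all_reals.
From mathcomp Require Import topology normedtype summability.

Set Implicit Arguments.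
Unset Strict Implicit.
Unset Printing Implicit Defensive.

Import Order.TTheory GRing.Theory Num.Theory.
Import numFieldNormedType.Exports.

Local Open Scope classical_set_scope.
Local Open Scope ring_scope.

(* Inner products are those of sesquilinear.v: linear in the first variable and
   conjugate-linear in the second. *)
HB.mixin Record isHilbert (C : numClosedFieldType) V & CompleteNormedModule C V := {
  hdot : {dot V for Num.conj};
  hdotxx : forall x : V, hdot x x = `|x| ^+ 2
}.

#[short(type="hilbertType")]
HB.structure Definition Hilbert (C : numClosedFieldType) :=
  {V of isHilbert C V & CompleteNormedModule C V}.

Section cauchy_schwarz.
Variables (C : numClosedFieldType) (V : lmodType C) (d : {dot V for Num.conj}).

Lemma dot_CS (u v : V) : `|d u v| ^+ 2 <= d u u * d v v.
Proof.
have [->|v0] := eqVneq v 0.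
  by rewrite !linear0r normr0 expr0n mulr0.
have dv : 0 < d v v by rewrite dnorm_gt0.
set a := d u v / d v v; pose t := `|d u v| ^+ 2 / d v v.
have tr : t^* = t.
  by apply/CrealP; rewrite ger0_real// divr_ge0// ?exprn_ge0// ltW.
have duw : d u (a *: v) = t.
  rewrite linearZr_LR /= /a rmorphM /= fmorphV /=.
  have /CrealP -> : d v v \is Num.real by rewrite gtr0_real.
  by rewrite mulrAC [_^* * _]mulrC -normCK.
have dww : d (a *: v) (a *: v) = t.
  rewrite dnormZ /a normf_div (gtr0_norm dv) expr_div_n /t.
  by rewrite [in X in _ / X]expr2 invfM mulrA mulfVK// gt_eqF.
have := dnorm_ge0 d (u - a *: v).
rewrite dnormB dww duw /= tr addrKA subr_ge0.
by rewrite /t ler_pdivrMr.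
Qed.

Definition dot_norm (u : V) : C := sqrtC (d u u).

Lemma dot_normK u : dot_norm u ^+ 2 = d u u.
Proof. exact: sqrtCK. Qed.

Lemma dot_norm_ge0 u : 0 <= dot_norm u.
Proof. exact: sqrt_dnorm_ge0. Qed.

Lemma dot_normZ a u : dot_norm (a *: u) = `|a| * dot_norm u.
Proof.
apply/eqP; rewrite -(eqrXn2 (n := 2)) ?mulr_ge0 ?dot_norm_ge0//.
by rewrite exprMn !dot_normK dnormZ.
Qed.

Lemma dot_norm_eq0 u : dot_norm u = 0 -> u = 0.
Proof. by move/eqP; rewrite sqrt_dnorm_eq0 => /eqP. Qed.

Lemma dot_norm_CS u v : `|d u v| <= dot_norm u * dot_norm v.
Proof.
rewrite -(ler_pXn2r (n := 2)) ?nnegrE ?mulr_ge0 ?dot_norm_ge0//.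
by rewrite exprMn !dot_normK dot_CS.
Qed.

Lemma dot_normD u v : dot_norm (u + v) <= dot_norm u + dot_norm v.
Proof.
rewrite -(ler_pXn2r (n := 2)) ?nnegrE ?addr_ge0 ?dot_norm_ge0//.
rewrite dot_normK dnormD sqrrD !dot_normK addrAC lerD2r lerD2l.
have -> : d u v + (d u v)^* = 'Re (d u v) *+ 2.
  by rewrite ReE -mulr_natr mulfVK ?pnatr_eq0.
rewrite lerMn2r /=; apply: le_trans (dot_norm_CS u v).
exact: le_trans (real_ler_norm (Creal_Re _)) (leif_normC_Re_Creal _).1.
Qed.

End cauchy_schwarz.

Section complex_complete.
Variable R : realType.
Local Notation C := R[i].

Lemma Re_le_norm (z : C) : (`|complex.Re z|)%:C%C <= `|z|.
Proof.
rewrite normc_def lecR -sqrtr_sqr ler_wsqrtr// lerDl sqr_ge0 //.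
Qed.

Lemma Im_le_norm (z : C) : (`|complex.Im z|)%:C%C <= `|z|.
Proof.
rewrite normc_def lecR -sqrtr_sqr ler_wsqrtr// lerDr sqr_ge0 //.
Qed.

Lemma norm_le_ReIm (z : C) :
  `|z| <= (`|complex.Re z| + `|complex.Im z|)%:C%C.
Proof.
rewrite {1}[z]complexE; apply: le_trans (ler_normD _ _) _.
rewrite normrM (_ : `|'i%C| = 1) ?mul1r; last first.
  by rewrite normc_def /= expr0n expr1n add0r sqrtr1.
rewrite rmorphD /= !normc_def /= !expr0n /= !addr0 !sqrtr_sqr //.
Qed.

Lemma complex_complete (F : set_system R[i]^o) :
  ProperFilter F -> cauchy F -> cvg F.
Proof.
move=> FF /cauchyP Fc.
have aux (p : C -> R) : {morph p : x y / x - y} ->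
    (forall z, (`|p z|)%:C%C <= `|z|) -> cvg (p @ F).
  move=> pB ple; apply: (@R_complete R).
  apply/cauchy_exP => e e0.
  have [|z Fz] := Fc (e%:C)%C; first by rewrite ltcR.
  exists (p z); rewrite /nbhs /= /fmap /=.
  apply: filterS Fz => w; rewrite -!ball_normE /ball_ /= => zw.
  by rewrite -ltcR -pB; apply: le_lt_trans (ple _) zw.
have /cvg_ex[/= a Fa] := aux (@complex.Re R) (raddfB _) Re_le_norm.
have /cvg_ex[/= b Fb] := aux (@complex.Im R) (raddfB _) Im_le_norm.
apply/cvg_ex; exists (a +i* b)%C; apply/cvgrPdist_lt => e e0.
have eE : e = ((complex.Re e)%:C)%C by rewrite RRe_real// gtr0_real.
have e0' : 0 < complex.Re e by rewrite -ltcR -eE.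
have e2 : 0 < complex.Re e / 2 by rewrite divr_gt0.
move/cvgrPdist_lt: Fa => /(_ _ e2) Fa; move/cvgrPdist_lt: Fb => /(_ _ e2) Fb.
apply: filterS2 Fa Fb => z /= za zb.
apply: le_lt_trans (norm_le_ReIm _) _.
rewrite eE ltcR [complex.Re e]splitr !raddfB /=.
by rewrite ltrD.
Qed.

End complex_complete.

Section limits.
Variable R : realType.
Local Notation C := R[i]^o.

Lemma cvg_conj (T : Type) (F : set_system T) (FF : Filter F) (u : T -> C) (l : C) :
  u @ F --> l -> (fun x => (u x)^* : C) @ F --> (l^* : C).
Proof.
move=> /cvgrPdist_lt ul; apply/cvgrPdist_lt => e /ul; apply: filterS => x.
by rewrite -rmorphB norm_conjC.
Qed.

Lemma lim_ge0 (T : Type) (F : set_system T) (FF : ProperFilter F) (u : T -> C) (l : C) :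
  u @ F --> l -> (\forall x \near F, 0 <= u x) -> 0 <= l.
Proof.
move=> ul u0.
suff <- : `|l| = l by [].
apply/eqP; rewrite -subr_eq0 -normr_eq0; apply/eqP/le_anti; rewrite normr_ge0 andbT.
apply/ler_addgt0Pl => e e0; rewrite addr0.
have e2 : 0 < e / 2 by rewrite divr_gt0.
move/cvgrPdist_lt: ul => /(_ _ e2) ul.
have [x [/= ux xl]] := filter_ex (filterI u0 ul).
rewrite (_ : `|l| - l = (`|l| - `|u x|) - (l - u x)); last first.
  by rewrite (ger0_norm ux) opprB addrA subrK.
apply: le_trans (ler_normB _ _) _; rewrite [e]splitr; apply: lerD; last exact: ltW.
by apply: le_trans (ler_dist_dist _ _) _; apply: ltW.
Qed.

Lemma lim_ge (T : Type) (F : set_system T) (FF : ProperFilter F) (u : T -> C) (l a : C) :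
  u @ F --> l -> (\forall x \near F, a <= u x) -> a <= l.
Proof.
move=> ul ua; rewrite -subr_ge0; apply: (@lim_ge0 _ F _ (fun x => u x - a)).
  by apply: cvgB ul _; exact: cvg_cst.
by apply: filterS ua => x; rewrite subr_ge0.
Qed.

Lemma lim_le (T : Type) (F : set_system T) (FF : ProperFilter F) (u : T -> C) (l a : C) :
  u @ F --> l -> (\forall x \near F, u x <= a) -> l <= a.
Proof.
move=> ul ua; rewrite -subr_ge0; apply: (@lim_ge0 _ F _ (fun x => a - u x)).
  by apply: cvgB ul; exact: cvg_cst.
by apply: filterS ua => x; rewrite subr_ge0.
Qed.

Lemma cvg_sum (T : Type) (I : Type) (F : set_system T) (FF : Filter F) (s : seq I)
    (u : I -> T -> C) (l : I -> C) :
  (forall i, u i @ F --> l i) ->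
  (fun x => \sum_(i <- s) u i x : C) @ F --> (\sum_(i <- s) l i : C).
Proof.
move=> ul; elim: s => [|i s IH].
  rewrite big_nil; under eq_fun do rewrite big_nil; exact: cvg_cst.
rewrite big_cons; under eq_fun do rewrite big_cons.
exact: cvgD (ul i) IH.
Qed.

Variable X : choiceType.

Lemma sum_fset_sub (V : zmodType) (A B : {fset X}) (a : X -> V) : (A `<=` B)%fset ->
  \sum_(x <- B) a x = \sum_(x <- A) a x + \sum_(x <- B | x \notin A) a x.
Proof.
move=> AB; rewrite (bigID (mem A)) /=; congr (_ + _).
rewrite big_fset_condE; apply: eq_fbigl => x; rewrite !inE /=.
by rewrite andbC andb_idr// => /(fsubsetP AB).
Qed.

Lemma ler_sum_fset (A B : {fset X}) (a : X -> C) : (forall x, 0 <= a x) ->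
  (A `<=` B)%fset -> \sum_(x <- A) a x <= \sum_(x <- B) a x.
Proof. by move=> a0 AB; rewrite (sum_fset_sub _ AB) lerDl sumr_ge0. Qed.

Lemma partial_sumE (V : zmodType) (a : X -> V) A : partial_sum a A = \sum_(x <- A) a x.
Proof. by rewrite big_seq_fsetE. Qed.

Lemma partial_sum_cvg (a : X -> C) (M : C) :
  (forall A : {fset X}, \sum_(x <- A) `|a x| <= M) ->
  cvg (partial_sum a @ totally).
Proof.
have FF : ProperFilter (@totally X) := totally_filter.
move=> aM; apply: (@complex_complete R); apply/cauchy_exP => e e0.
pose E := [set r : R | exists A : {fset X}, r%:C%C = \sum_(x <- A) `|a x|].
have sumE A : (complex.Re (\sum_(x <- A) `|a x|))%:C%C = \sum_(x <- A) `|a x|.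
  by rewrite RRe_real// ger0_real// sumr_ge0.
have Es : has_sup E.
  split; first by exists 0, fset0; rewrite big_nil.
  exists (complex.Re M); apply/ubP => r [A rA].
  by have := aM A; rewrite -rA lecE => /andP[_].
have eE : e = ((complex.Re e)%:C)%C by rewrite RRe_real// gtr0_real.
have e0' : 0 < complex.Re e by rewrite -ltcR -eE.
have [r [A rA] rs] := sup_adherent e0' Es.
exists (partial_sum a A); exists A => // B /= AB.
rewrite -ball_normE /= distrC !partial_sumE (sum_fset_sub a AB) addrAC subrr add0r.
apply: le_lt_trans (ler_norm_sum _ _ _) _.
rewrite -(ltrD2l (\sum_(x <- A) `|a x|)) -(sum_fset_sub _ AB) -rA -sumE eE -rmorphD /= ltcR.
apply: (@le_lt_trans _ _ (sup E)).
  by move/ubP: (sup_upper_bound Es); apply; exists B; exact: sumE.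
by rewrite -ltrBlDr.
Qed.

End limits.

Section ell2.
Variables (R : realType) (X : choiceType).
Local Notation C := R[i]^o.

Definition ell2_pred : {pred X -> C} := fun f =>
  `[< exists M : C, forall A : {fset X}, \sum_(x <- A) `|f x| ^+ 2 <= M >].

Lemma normB_sq_ge0 (K : numDomainType) (a b : K) : 0 <= (`|a| - `|b|) ^+ 2.
Proof. by rewrite real_exprn_even_ge0// rpredB// ger0_real. Qed.

Lemma normD_sq (K : numDomainType) (a b : K) :
  `|a + b| ^+ 2 <= 2 * (`|a| ^+ 2 + `|b| ^+ 2).
Proof.
apply: (@le_trans _ _ ((`|a| + `|b|) ^+ 2)).
  by rewrite lerXn2r ?nnegrE ?addr_ge0// ler_normD.
rewrite -subr_ge0 (_ : _ - _ = (`|a| - `|b|) ^+ 2); last by ring.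
exact: normB_sq_ge0.
Qed.

Lemma normM_sq (K : numDomainType) (a b : K) :
  `|a| * `|b| <= `|a| ^+ 2 + `|b| ^+ 2.
Proof.
rewrite -(ler_pM2l (_ : 0 < 2)) ?ltr0n// -subr_ge0.
rewrite (_ : _ - _ = `|a| ^+ 2 + `|b| ^+ 2 + (`|a| - `|b|) ^+ 2); last by ring.
by rewrite addr_ge0 ?normB_sq_ge0// addr_ge0// exprn_ge0.
Qed.

Fact ell2_submod_closed : subsemimod_closed ell2_pred.
Proof.
split; first split.
- apply/asboolP; exists 0 => A; rewrite big1// => x _.
  by rewrite normr0 expr0n.
- move=> f g /asboolP[M fM] /asboolP[N gN]; apply/asboolP.
  exists (2 * (M + N)) => A.
  apply: (@le_trans _ _ (\sum_(x <- A) 2 * (`|f x| ^+ 2 + `|g x| ^+ 2))).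
    by apply: ler_sum => x _; exact: normD_sq.
  by rewrite -mulr_sumr big_split /= ler_pM2l// lerD.
- move=> a f /asboolP[M fM]; apply/asboolP.
  exists (`|a| ^+ 2 * M) => A.
  under eq_bigr do rewrite /= normrZ exprMn.
  by rewrite -mulr_sumr ler_wpM2l// exprn_ge0.
Qed.
HB.instance Definition _ :=
  GRing.isSubmodClosed.Build R[i] (X -> C) ell2_pred ell2_submod_closed.

Record ell2 := MkEll2 { ell2_fun :> X -> C; _ : ell2_fun \in ell2_pred }.
HB.instance Definition _ := [isSub for ell2_fun].
HB.instance Definition _ := [Choice of ell2 by <:].
HB.instance Definition _ := [SubChoice_isSubLmodule of ell2 by <:].

Lemma ell2P (f : ell2) : exists M : C, forall A : {fset X},
  \sum_(x <- A) `|f x| ^+ 2 <= M.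
Proof. exact/asboolP/(valP f). Qed.

Lemma ell2_ext (f g : ell2) : (forall x, f x = g x) -> f = g.
Proof. by move=> fg; apply/val_inj/funext. Qed.

(* `summability.sum` is the limit of the finite partial sums along the directed
   set of finite subsets of X, so X may be uncountable. *)
Definition ell2_dot (f g : ell2) : C := summability.sum (fun x => f x * (g x)^* : C).

Lemma ell2_dot_cvg (f g : ell2) :
  partial_sum (fun x => f x * (g x)^* : C) @ totally --> ell2_dot f g.
Proof.
have [M fM] := ell2P f; have [N gN] := ell2P g.
apply: (@partial_sum_cvg _ _ _ (M + N)) => A.
apply: le_trans (lerD (fM A) (gN A)).
rewrite -big_split /=; apply: ler_sum => x _.
by rewrite normrM norm_conjC normM_sq.
Qed.

Arguments ell2_dot_cvg : clear implicits.

#[local] Existing Instance totally_filter.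

Lemma ell2_dotP (f g : ell2) (l : C) :
  partial_sum (fun x => f x * (g x)^* : C) @ totally --> l -> ell2_dot f g = l.
Proof. by move=> fgl; apply: (@cvg_lim C _ _ _ _ _ _ fgl). Qed.

Fact ell2_dotl a f g h : ell2_dot (a *: f + g) h = a * ell2_dot f h + ell2_dot g h.
Proof.
apply: ell2_dotP.
rewrite (_ : partial_sum _ = (fun A => (a : R[i]) *: (partial_sum (fun x => f x * (h x)^* : C) A) +
    partial_sum (fun x => g x * (h x)^* : C) A)).
  by apply: cvgD (ell2_dot_cvg g h); exact: cvgZl_tmp (ell2_dot_cvg f h).
apply/funext => A; rewrite !partial_sumE scaler_sumr -big_split /=; apply: eq_bigr => x _.
by rewrite mulrDl -!mulrA.
Qed.

Fact ell2_dotC f g : ell2_dot f g = (ell2_dot g f)^*.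
Proof.
apply: ell2_dotP.
rewrite (_ : partial_sum _ = (fun A => (partial_sum (fun x => g x * (f x)^* : C) A)^* : C)).
  exact: cvg_conj (ell2_dot_cvg g f).
apply/funext => A; rewrite !partial_sumE rmorph_sum; apply: eq_bigr => x _.
by rewrite /= rmorphM /= conjCK mulrC.
Qed.

Lemma ell2_ler_dot (f : ell2) (A : {fset X}) : \sum_(x <- A) `|f x| ^+ 2 <= ell2_dot f f.
Proof.
apply: (@lim_ge _ _ _ _ _ _ _ (ell2_dot_cvg f f)); exists A => // B /= AB.
rewrite partial_sumE; under [leRHS]eq_bigr do rewrite -normCK.
by apply: ler_sum_fset => // x; rewrite exprn_ge0.
Qed.

Lemma ell2_dot_ler (f : ell2) (M : C) :
  (forall A : {fset X}, \sum_(x <- A) `|f x| ^+ 2 <= M) -> ell2_dot f f <= M.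
Proof.
move=> fM; apply: (@lim_le _ _ _ _ _ _ _ (ell2_dot_cvg f f)); apply: filterE => A.
by rewrite partial_sumE; under eq_bigr do rewrite -normCK.
Qed.

Fact ell2_dot_gt0 f : f != 0 -> 0 < ell2_dot f f.
Proof.
move=> f0; have [x fx] : exists x, f x != 0.
  apply: contrapT => /forallNP f00; move/eqP: f0; apply.
  by apply: ell2_ext => x; move/negP/negPn/eqP: (f00 x).
apply: lt_le_trans (ell2_ler_dot f [fset x]%fset).
by rewrite big_seq_fset1 exprn_gt0// normr_gt0.
Qed.

Fact ell2_dot_bilinear :
  bilinear_for (GRing.Scale.Law.clone _ _ ( *%R : R[i] -> R[i] -> R[i]) _)
    (GRing.Scale.Law.clone _ _ (Num.conj \; *%R) _) (ell2_dot : ell2 -> ell2 -> R[i]).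
Proof.
split=> [h a f g|f a g h]; first exact: ell2_dotl.
by rewrite ell2_dotC ell2_dotl rmorphD rmorphM /= -!ell2_dotC.
Qed.

HB.instance Definition _ := bilinear_isBilinear.Build R[i] ell2 ell2 R[i]
  _ _ (ell2_dot : ell2 -> ell2 -> R[i]) ell2_dot_bilinear.
HB.instance Definition _ := isHermitianSesquilinear.Build R[i] ell2 false Num.conj
  (ell2_dot : ell2 -> ell2 -> R[i])
  (fun f g => etrans (ell2_dotC f g) (esym (mul1r _))).
HB.instance Definition _ := isDotProduct.Build R[i] ell2
  (ell2_dot : ell2 -> ell2 -> R[i]) ell2_dot_gt0.

End ell2.
Arguments ell2_dot {R X} f g.

Section ell2_hilbert.
Variables (R : realType) (X : choiceType).
Local Notation C := R[i]^o.
Local Notation ell2 := (ell2 R X).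

Let dot : {dot ell2 for Num.conj} := (ell2_dot : ell2 -> ell2 -> R[i]).

HB.instance Definition _ := @Lmodule_isNormed.Build R[i] ell2
  (dot_norm dot) (@dot_normD _ _ dot) (@dot_normZ _ _ dot) (@dot_norm_eq0 _ _ dot).

Lemma ell2_norm_sq (f : ell2) : `|f| ^+ 2 = ell2_dot f f.
Proof. exact: (dot_normK dot). Qed.

Lemma ell2_ler_norm (f : ell2) x : `|f x| <= `|f|.
Proof.
rewrite -(ler_pXn2r (n := 2)) ?nnegrE// ell2_norm_sq.
by have := ell2_ler_dot f [fset x]%fset; rewrite big_seq_fset1.
Qed.

Lemma ell2_norm_ler (f : ell2) (M : R[i]) : 0 <= M ->
  (forall A : {fset X}, \sum_(x <- A) `|f x| ^+ 2 <= M ^+ 2) -> `|f| <= M.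
Proof.
move=> M0 fM; rewrite -(ler_pXn2r (n := 2)) ?nnegrE// ell2_norm_sq.
exact: ell2_dot_ler.
Qed.

Lemma ell2_complete (F : set_system ell2) : ProperFilter F -> cauchy F -> cvg F.
Proof.
move=> FF /cauchyP Fc.
have ev x : cvg ((fun f : ell2 => f x : C) @ F).
  apply: (@complex_complete R); apply/cauchy_exP => e /Fc[f Ff].
  exists (f x); rewrite /nbhs /= /fmap /=; apply: filterS Ff => g.
  rewrite -!ball_normE /= => fg; apply: le_lt_trans fg.
  exact: (ell2_ler_norm (f - g) x).
pose h x : C := lim ((fun f : ell2 => f x : C) @ F).
have hE x : (fun f : ell2 => f x : C) @ F --> h x by exact: ev.
have key (f : ell2) e : 0 <= e -> F (ball f e) ->
    forall A : {fset X}, \sum_(x <- A) `|f x - h x| ^+ 2 <= e ^+ 2.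
  move=> e0 Ff A.
  have cv : (fun g : ell2 => \sum_(x <- A) `|f x - g x| ^+ 2 : C) @ F -->
      (\sum_(x <- A) `|f x - h x| ^+ 2 : C).
    apply: cvg_sum => x; rewrite expr2; under eq_fun do rewrite expr2.
    have nx : (fun g : ell2 => `|f x - g x| : C) @ F --> (`|f x - h x| : C).
      by apply: cvg_norm; apply: cvgB (hE x); exact: cvg_cst.
    exact: (@cvgM R[i] _ _ _ _ _ _ _ nx nx).
  apply: (@lim_le _ _ _ _ _ _ _ cv); apply: filterS Ff => g.
  rewrite -ball_normE /= => fg; apply: le_trans (ell2_ler_dot (f - g) A) _.
  by rewrite -ell2_norm_sq lerXn2r ?nnegrE// ltW.
have [f0 Ff0] := Fc 1 ltr01.
have u_ell2 : (fun x => f0 x - h x : C) \in @ell2_pred R X.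
  by apply/asboolP; exists (1 ^+ 2); apply: key.
have h_ell2 : h \in @ell2_pred R X.
  rewrite (_ : h = (f0 : X -> C) - (fun x => f0 x - h x : C)).
    by rewrite rpredB// (valP f0).
  by apply/funext => x; rewrite !fctE opprB addrC subrK.
apply/cvg_ex; exists (MkEll2 h_ell2); apply/cvgrPdist_lt => e e0.
have e2 : 0 < e / 2 by rewrite divr_gt0.
have [f Ff] := Fc _ e2.
apply: filterS (Ff) => g; rewrite -ball_normE /= => fg.
rewrite -(subrKA f); apply: le_lt_trans (ler_normD _ _) _.
rewrite [e]splitr; apply: ler_ltD fg.
rewrite distrC; apply: ell2_norm_ler; first exact: ltW.
exact: (key f (e / 2) (ltW e2) Ff).
Qed.

HB.instance Definition _ := Uniform_isComplete.Build ell2 ell2_complete.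

HB.instance Definition _ := isHilbert.Build R[i] ell2
  (fun f => esym (ell2_norm_sq f) : dot f f = `|f| ^+ 2).

End ell2_hilbert.

Section cosets.
Variables (G : groupType) (H : groupClosed G).
Local Open Scope group_scope.

(* G/H and H\G/H consist of the cosets themselves, as subsets of G; `lrep` and
   `drep` choose a representative. *)
Definition lcoset_set (x : G) : set G := [set x * h | h in [set` H]].
Definition dcoset_set (x : G) : set G :=
  [set h * x * k | h in [set` H] & k in [set` H]].

Definition lcosets := {A : set G | `[< exists x, A = lcoset_set x >]}.
Definition dcosets := {A : set G | `[< exists x, A = dcoset_set x >]}.

HB.instance Definition _ := Choice.on lcosets.
HB.instance Definition _ := Choice.on dcosets.

Definition lcos (x : G) : lcosets :=
  exist _ (lcoset_set x) (introT (asboolP _) (ex_intro _ x erefl)).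
Definition dcos (x : G) : dcosets :=
  exist _ (dcoset_set x) (introT (asboolP _) (ex_intro _ x erefl)).

Definition lrep (U : lcosets) : G := xget 1 (val U).
Definition drep (D : dcosets) : G := xget 1 (val D).

Definition cosets_in (x : G) : set lcosets :=
  [set U : lcosets | val U `<=` dcoset_set x].

Definition hecke_pair := forall x : G, finite_set (cosets_in x).

Lemma lcoset_setP x y : lcoset_set x y <-> x^-1 * y \in H.
Proof.
split=> [[h /= Hh <-]|xyH]; first by rewrite mulKg.
by exists (x^-1 * y); rewrite //= mulVKg.
Qed.

Lemma lcosP x y : lcos x = lcos y <-> x^-1 * y \in H.
Proof.
split=> [/(congr1 val) /= xy|xyH].
  by apply/lcoset_setP; rewrite xy; apply/lcoset_setP; rewrite mulVg gpred1.
apply/val_inj/seteqP => /=; split=> z /lcoset_setP zH; apply/lcoset_setP.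
  by rewrite -(mulVKg x z) mulgA gpredM// -gpredV invgM invgK.
by rewrite -(mulVKg y z) mulgA gpredM.
Qed.

Lemma dcoset_setP x y :
  dcoset_set x y <-> exists h k, [/\ h \in H, k \in H & y = h * x * k].
Proof.
split=> [[h /= Hh [k Hk <-]]|[h [k [Hh Hk ->]]]]; first by exists h, k.
by exists h => //; exists k.
Qed.

Lemma dcosP x y : dcos x = dcos y <-> dcoset_set x y.
Proof.
split=> [/(congr1 val) /= ->|/dcoset_setP[h [k [Hh Hk ->]]]].
  by apply/dcoset_setP; exists 1, 1; rewrite !gsimp !gpred1.
apply/val_inj/seteqP => /=; split=> z /dcoset_setP[h' [k' [Hh' Hk' ->]]];
    apply/dcoset_setP.
  exists (h' * h^-1), (k^-1 * k'); split; try by rewrite gpredM// gpredV.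
  by rewrite !mulgA mulgVK mulgK.
exists (h' * h), (k * k'); split; try by rewrite gpredM.
by rewrite !mulgA.
Qed.

Lemma lrepP U : val U (lrep U).
Proof.
apply: xgetPex; case: U => A /= AU; have /asboolP[x ->] := AU.
by exists x; apply/lcoset_setP; rewrite mulVg gpred1.
Qed.

Lemma lrepK U : lcos (lrep U) = U.
Proof.
have [x ->] : exists x, U = lcos x.
  by case: U => A AU; have /asboolP[x xA] := AU; exists x; exact/val_inj.
by apply/esym/lcosP/lcoset_setP; exact: (lrepP (lcos x)).
Qed.

Lemma drepP D : val D (drep D).
Proof.
apply: xgetPex; case: D => A /= AD; have /asboolP[x ->] := AD.
by exists x; apply/dcosP.
Qed.

Lemma drepK D : dcos (drep D) = D.
Proof.
have [x ->] : exists x, D = dcos x.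
  by case: D => A AD; have /asboolP[x xA] := AD; exists x; exact/val_inj.
by apply/esym/dcosP; exact: (drepP (dcos x)).
Qed.

Lemma dcos_mulHr x h : h \in H -> dcos (x * h) = dcos x.
Proof.
by move=> Hh; apply/esym/dcosP/dcoset_setP; exists 1, h; rewrite gpred1 mul1g.
Qed.

Lemma dcos_mulHl h x : h \in H -> dcos (h * x) = dcos x.
Proof.
by move=> Hh; apply/esym/dcosP/dcoset_setP; exists h, 1; rewrite gpred1 mulg1.
Qed.

Lemma lcos_dcos x y : lcos x = lcos y -> dcos x = dcos y.
Proof. by move=> /lcosP xy; rewrite -(mulVKg x y) dcos_mulHr. Qed.

Lemma lcos_mull x y z : lcos y = lcos z -> lcos (x * y) = lcos (x * z).
Proof. by move=> /lcosP yz; apply/lcosP; rewrite invgM -mulgA mulKg. Qed.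

Lemma lrep_lcos x : exists2 h, h \in H & lrep (lcos x) = x * h.
Proof.
exists (x^-1 * lrep (lcos x)); last by rewrite mulVKg.
by apply/lcosP; rewrite lrepK.
Qed.

Lemma dcos_inv x y : dcos x = dcos y -> dcos x^-1 = dcos y^-1.
Proof.
move=> /dcosP/dcoset_setP[h [k [Hh Hk ->]]]; rewrite !invgM.
by rewrite dcos_mulHl ?gpredV// dcos_mulHr ?gpredV.
Qed.

Lemma cosets_inP a U : cosets_in a U <-> dcos (lrep U) = dcos a.
Proof.
split=> [Ua|Ua x Ux]; first exact/esym/dcosP/Ua/lrepP.
apply/dcosP; rewrite -Ua; apply: lcos_dcos; rewrite lrepK.
by move: Ux; rewrite -{1}(lrepK U) => /lcoset_setP/lcosP <-; rewrite lrepK.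
Qed.

End cosets.

Arguments cosets_in {G} H x.
Arguments lcos {G} H x.
Arguments dcos {G} H x.

Section c0.
Variables (R : realType) (X : choiceType).
Local Notation C := R[i]^o.

Definition c0_pred : {pred X -> C} := fun f =>
  `[< forall e : R[i], 0 < e -> finite_set [set x | e <= `|f x|] >].

Fact c0_submod_closed : subsemimod_closed c0_pred.
Proof.
split; first split.
- apply/asboolP => e e0; apply: sub_finite_set (finite_set0 X) => x /=.
  by rewrite normr0 (lt_geF e0).
- move=> f g /asboolP f0 /asboolP g0; apply/asboolP => e e0.
  have e2 : 0 < e / 2 by rewrite divr_gt0.
  apply: (@sub_finite_set _ _ ([set x | e / 2 <= `|f x|] `|` [set x | e / 2 <= `|g x|])).
    move=> x /= efg; apply/orP; apply: contraTT efg; rewrite negb_or.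
    have nr (z : R[i]) : (e / 2 <= `|z|) = ~~ (`|z| < e / 2).
      by rewrite real_leNgt// ?ger0_real// ltW.
    rewrite !nr !negbK => /andP[fe ge]; rewrite -real_ltNge ?normr_real ?gtr0_real//.
    by rewrite [e]splitr; apply: le_lt_trans (ler_normD _ _) (ltrD _ _).
  by rewrite finite_setU; split; [exact: f0|exact: g0].
- move=> a f /asboolP f0; apply/asboolP => e e0.
  have a1 : 0 < `|a| + 1 by rewrite ltr_wpDl.
  apply: sub_finite_set (f0 (e / (`|a| + 1)) (divr_gt0 e0 a1)) => x /=.
  rewrite normrM ler_pdivrMr// mulrC => /le_trans; apply.
  by rewrite ler_wpM2l// lerDl.
Qed.
HB.instance Definition _ :=
  GRing.isSubmodClosed.Build R[i] (X -> C) c0_pred c0_submod_closed.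

Record c0 := MkC0 { c0_fun :> X -> C; _ : c0_fun \in c0_pred }.
HB.instance Definition _ := [isSub for c0_fun].
HB.instance Definition _ := [Choice of c0 by <:].
HB.instance Definition _ := [SubChoice_isSubLmodule of c0 by <:].

Lemma c0P (f : c0) (e : R[i]) : 0 < e -> finite_set [set x | e <= `|f x|].
Proof. by case: f => f /= /asboolP; apply. Qed.

Fact c0_mul_subproof (f g : c0) : (fun x => f x * g x : C) \in c0_pred.
Proof.
apply/asboolP => e e0.
apply: (@sub_finite_set _ _ ([set x | e <= `|f x|] `|` [set x | 1 <= `|g x|])).
  move=> x /= efg; apply/orP; apply: contraTT efg; rewrite negb_or.
  have nr (c z : R[i]) : 0 < c -> (c <= `|z|) = ~~ (`|z| < c).
    by move=> c0; rewrite real_leNgt// ?ger0_real// ltW.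
  rewrite !nr// !negbK => /andP[fe ge].
  by rewrite normrM -[e]mulr1 ltr_pM.
by rewrite finite_setU; split; exact: c0P.
Qed.
Definition c0_mul (f g : c0) : c0 := MkC0 (c0_mul_subproof f g).

Fact c0_star_subproof (f : c0) : (fun x => (f x)^* : C) \in c0_pred.
Proof.
apply/asboolP => e e0; apply: sub_finite_set (c0P f e0) => x /=.
by rewrite norm_conjC.
Qed.
Definition c0_star (f : c0) : c0 := MkC0 (c0_star_subproof f).

Fact c0_eps_subproof (x : X) : (fun y => (y == x)%:R : C) \in c0_pred.
Proof.
apply/asboolP => e e0; apply: sub_finite_set (finite_set1 x) => y /=.
by case: eqP => //= _; rewrite normr0 (lt_geF e0).
Qed.
Definition c0_eps (x : X) : c0 := MkC0 (c0_eps_subproof x).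

End c0.

Section hecke.
Variables (R : realType) (G : groupType) (H : groupClosed G).
Local Notation C := R[i]^o.
Local Notation X := (lcosets H).

Definition hecke_pred : {pred dcosets H -> C} := fun f =>
  `[< finite_set [set d | f d != 0] >].

Fact hecke_submod_closed : subsemimod_closed hecke_pred.
Proof.
split; first split.
- apply/asboolP; apply: sub_finite_set (finite_set0 _) => d /=.
  by rewrite eqxx.
- move=> f g /asboolP ff /asboolP fg; apply/asboolP.
  apply: (@sub_finite_set _ _ ([set d | f d != 0] `|` [set d | g d != 0])).
    move=> d /= fgd; apply/orP; apply: contraNT fgd; rewrite negb_or !negbK.
    by move=> /andP[/eqP fd /eqP gd]; rewrite !fctE fd gd addr0.
  by rewrite finite_setU; split.
- move=> a f /asboolP ff; apply/asboolP; apply: sub_finite_set ff => d /=.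
  by apply: contra => /eqP fd; rewrite !fctE fd scaler0.
Qed.
HB.instance Definition _ :=
  GRing.isSubmodClosed.Build R[i] (dcosets H -> C) hecke_pred hecke_submod_closed.

Record hecke := MkHecke { hecke_fun :> dcosets H -> C; _ : hecke_fun \in hecke_pred }.
HB.instance Definition _ := [isSub for hecke_fun].
HB.instance Definition _ := [Choice of hecke by <:].
HB.instance Definition _ := [SubChoice_isSubLmodule of hecke by <:].

Lemma heckeP (f : hecke) : finite_set [set d | f d != 0].
Proof. by case: f => f /= /asboolP. Qed.

Fact hecke_char_subproof (a : G) : (fun d => (d == dcos H a)%:R : C) \in hecke_pred.
Proof.
apply/asboolP; apply: sub_finite_set (finite_set1 (dcos H a)) => d /=.
by have [->//|_] := eqVneq d (dcos H a); rewrite mulr0n eqxx.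
Qed.
Definition hecke_char (a : G) : hecke := MkHecke (hecke_char_subproof a).

Fact hecke_star_subproof (f : hecke) :
  (fun d => (f (dcos H (drep d)^-1%g))^* : C) \in hecke_pred.
Proof.
apply/asboolP.
apply: sub_finite_set (finite_image (fun d => dcos H (drep d)^-1%g) (heckeP f)) => d /=.
rewrite conjC_eq0 => fd; exists (dcos H (drep d)^-1%g) => //.
rewrite -[RHS]drepK -[in RHS](invgK (drep d)); apply: dcos_inv.
by rewrite drepK.
Qed.
Definition hecke_star (f : hecke) : hecke := MkHecke (hecke_star_subproof f).

Lemma hecke_starE (f : hecke) x : hecke_star f (dcos H x) = (f (dcos H x^-1%g))^*.
Proof. by rewrite /= (dcos_inv (drepK (dcos H x))). Qed.

Variable hH : hecke_pair H.

Lemma hecke_supp_finite (f : hecke) : finite_set [set W : X | f (dcos H (lrep W)) != 0].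
Proof.
have : finite_set (\bigcup_(d in [set d | f d != 0]) cosets_in H (drep d)).
  by apply: bigcup_finite => [|d _]; [exact: heckeP|exact: hH].
apply: sub_finite_set => W /= fW; exists (dcos H (lrep W)) => //.
by apply/cosets_inP; rewrite drepK.
Qed.

(* The sum is finite because f is supported on finitely many left cosets, and it
   does not depend on the representatives: see `hecke_mulE` below. *)
Definition hecke_conv (f g : hecke) : dcosets H -> C := fun d =>
  \sum_(Y \in [set: X]) f (dcos H (lrep Y)) * g (dcos H ((lrep Y)^-1 * drep d)%g).

Fact hecke_mul_subproof (f g : hecke) : hecke_conv f g \in hecke_pred.
Proof.
apply/asboolP.
have := finite_image2 (fun U W : X => dcos H (lrep U * lrep W)%g)
  (hecke_supp_finite f) (hecke_supp_finite g).
apply: sub_finite_set => d /=; apply: contraNP => nd; apply/eqP.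
rewrite /hecke_conv fsbig1// => Y _; apply/eqP; rewrite mulf_eq0.
apply: contra_notT nd; rewrite negb_or => /andP[fY gY].
exists Y => //; exists (lcos H ((lrep Y)^-1 * drep d)%g).
  by rewrite /= (lcos_dcos (lrepK (lcos H _))).
have [h Hh ->] := lrep_lcos H ((lrep Y)^-1 * drep d)%g.
by rewrite mulgA mulVKg dcos_mulHr// drepK.
Qed.
Definition hecke_mul (f g : hecke) : hecke := MkHecke (hecke_mul_subproof f g).

End hecke.

Section M.
Variables (R : realType) (X : choiceType).
Local Notation C := R[i]^o.

Lemma c0_bounded (f : c0 R X) : exists2 M : R[i], 0 <= M & forall x, `|f x| <= M.
Proof.
have fin := c0P f ltr01.
pose A := fset_set [set x | 1 <= `|f x|].
have s0 : 0 <= \sum_(x <- A) `|f x| by rewrite sumr_ge0.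
exists (1 + \sum_(x <- A) `|f x|); first by rewrite addr_ge0.
move=> x; have [|] := real_leP (normr_real (f x)) (real1 _).
  by move=> /le_trans; apply; rewrite lerDl.
move=> /ltW fx; apply: ler_wpDl => //.
have xA : x \in A by rewrite in_fset_set// inE.
by rewrite (big_fsetD1 x)//= lerDl sumr_ge0.
Qed.

Fact mult_subproof (f : c0 R X) (xi : ell2 R X) :
  (fun x => f x * xi x : C) \in @ell2_pred R X.
Proof.
have [M M0 fM] := c0_bounded f; have [N xiN] := ell2P xi.
apply/asboolP; exists (M ^+ 2 * N) => A.
apply: (@le_trans _ _ (\sum_(x <- A) M ^+ 2 * `|xi x| ^+ 2)); last first.
  by rewrite -mulr_sumr ler_wpM2l// exprn_ge0.
apply: ler_sum => x _; rewrite normrM exprMn ler_wpM2r ?exprn_ge0//.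
by rewrite lerXn2r ?nnegrE.
Qed.
Definition mult_op (f : c0 R X) (xi : ell2 R X) : ell2 R X :=
  MkEll2 (mult_subproof f xi).

Fact ell2_eps_subproof (x : X) : (fun y => (y == x)%:R : C) \in @ell2_pred R X.
Proof.
apply/asboolP; exists 1 => A.
have [xA|xA] := boolP (x \in A).
  rewrite (big_fsetD1 x)//= eqxx normr1 expr1n big_seq big1 ?addr0// => y.
  by rewrite !inE => /andP[/negbTE -> _]; rewrite normr0 expr0n.
rewrite big_seq big1 ?ler01// => y yA.
by case: eqP yA xA => [-> ->|]//; rewrite normr0 expr0n.
Qed.
Definition ell2_eps (x : X) : ell2 R X := MkEll2 (ell2_eps_subproof x).

Lemma ell2_comp (Y : eqType) (phi : X -> X) (k : X -> X -> Y) (T : seq Y)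
    (xi : ell2 R X) :
  (forall z, k (phi z) z \in T) ->
  (forall z z', phi z = phi z' -> k (phi z) z = k (phi z) z' -> z = z') ->
  (fun z => xi (phi z) : C) \in @ell2_pred R X.
Proof.
move=> kT kI; have [N xiN] := ell2P xi.
apply/asboolP; exists (N *+ size T) => A.
rewrite (partition_big_imfset _ phi) /=.
apply: (@le_trans _ _ (\sum_(y <- [fset phi x | x in A]%fset) `|xi y| ^+ 2 *+ size T)).
  apply: ler_sum => y _.
  under eq_bigr => z /eqP -> do [].
  rewrite big_const_seq iter_addr_0; apply: ler_wpMn2l; first exact: exprn_ge0.
  rewrite -size_filter -(size_map (k y)); apply: uniq_leq_size.
    rewrite map_inj_in_uniq ?filter_uniq// => z z'.
    rewrite !mem_filter => /andP[/eqP <- _] /andP[/eqP zz' _] kzz'.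
    by apply: kI => //; rewrite zz'.
  move=> w /mapP[z]; rewrite mem_filter => /andP[/eqP <- _] ->; exact: kT.
by rewrite sumrMnl lerMn2r xiN orbT.
Qed.
End M.

Section rho.
Variables (R : realType) (G : groupType) (H : groupClosed G).
Hypothesis hH : hecke_pair H.
Local Notation C := R[i]^o.
Local Notation X := (lcosets H).

(* The bounded extension to l^2(G/H) of the operator given on the basis vectors
   by the formula `rho_eps` below: the coefficient of rho([HaH]) eps_yH at zH is 1
   if z^-1 y is in HaH and 0 otherwise, whence
   (rho(f) xi)(zH) = sum over wH of f(HwH) xi(zwH). *)
Definition rho_fun (f : hecke R H) (xi : ell2 R X) : X -> C := fun Z =>
  \sum_(W \in [set: X]) f (dcos H (lrep W)) * xi (lcos H (lrep Z * lrep W)%g).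

Lemma ell2_translate (w : G) (xi : ell2 R X) :
  (fun Z => xi (lcos H (lrep Z * w)%g) : C) \in @ell2_pred R X.
Proof.
apply: (@ell2_comp R X X (fun Z => lcos H (lrep Z * w)%g)
  (fun Y Z => lcos H ((lrep Y)^-1 * lrep Z)%g) (fset_set (cosets_in H w^-1%g))).
  move=> Z; rewrite in_fset_set; last exact: hH.
  rewrite inE; apply/cosets_inP; rewrite (lcos_dcos (lrepK _)).
  have [h Hh ->] := lrep_lcos H (lrep Z * w)%g.
  by rewrite !invgM -!mulgA mulVg mulg1 dcos_mulHl ?gpredV.
move=> Z Z' _ e; rewrite -(lrepK Z) -(lrepK Z').
by have := lcos_mull (lrep (lcos H (lrep Z * w)%g)) e; rewrite !mulVKg.
Qed.

Lemma rho_funE (f : hecke R H) (xi : ell2 R X) : rho_fun f xi =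
  \sum_(W <- fset_set [set W : X | f (dcos H (lrep W)) != 0])
    f (dcos H (lrep W)) *: ((fun Z => xi (lcos H (lrep Z * lrep W)%g)) : X -> C).
Proof.
apply/funext => Z; rewrite fct_sumE /rho_fun.
rewrite -(fsbig_widen [set W : X | f (dcos H (lrep W)) != 0])//; last first.
  by move=> W [_ /= /negP/negPn/eqP ->]; rewrite mul0r.
by rewrite fsbig_finite//; exact: hecke_supp_finite.
Qed.

Fact rho_subproof (f : hecke R H) (xi : ell2 R X) :
  rho_fun f xi \in @ell2_pred R X.
Proof.
rewrite rho_funE; apply: rpred_sum => W _; apply: rpredZ.
exact: ell2_translate.
Qed.
Definition rho (f : hecke R H) (xi : ell2 R X) : ell2 R X :=
  MkEll2 (rho_subproof f xi).

Lemma rho_eps (a y : G) : rho (hecke_char R H a) (ell2_eps R (lcos H y)) =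
  \sum_(U \in cosets_in H a^-1%g) ell2_eps R (lcos H (y * lrep U)%g).
Proof.
apply: ell2_ext => Z.
have lE (z : G) : (Z == lcos H (y * z)%g) = (lcos H z == lcos H (y^-1 * lrep Z)%g).
  apply/eqP/eqP => [->|]; last first.
    by move=> /(lcos_mull y) ->; rewrite mulVKg lrepK.
  apply/lcosP; have [h Hh ->] := lrep_lcos H (y * z)%g.
  by rewrite -!mulgA mulKg mulKg.
have dE (z w : G) : dcos H z = dcos H w -> dcos H z^-1%g = dcos H w^-1%g.
  exact: dcos_inv.
pose W0 := lcos H ((lrep Z)^-1 * y)%g; pose U0 := lcos H (y^-1 * lrep Z)%g.
transitivity ((dcos H ((lrep Z)^-1 * y)%g == dcos H a)%:R : C).
  rewrite /= /rho_fun -(fsbig_widen [set W0])//=; last first.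
    move=> W [_ /= WW0]; have [e|_] := eqVneq (lcos H (lrep Z * lrep W)%g) (lcos H y);
      last by rewrite mulr0.
    case: WW0; rewrite -(lrepK W); apply/lcosP; move/lcosP: e.
    by rewrite invgM mulgA.
  rewrite fsbig_set1 (lcos_dcos (lrepK W0)) (lcos_mull (lrep Z) (lrepK W0)).
  by rewrite mulVKg eqxx mulr1.
rewrite fsbig_finite; last exact: hH.
rewrite -[RHS]/(val _ Z) raddf_sum fct_sumE -fsbig_finite; last exact: hH.
under eq_fsbigr do rewrite /= lE lrepK.
have [e|ne] := eqVneq; last first.
  rewrite fsbig1// => U /cosets_inP Ua; case: eqP => // UU0.
  move/eqP: ne; case; rewrite -[dcos H a](congr1 (dcos H) (invgK a)).
  rewrite -(dE _ _ Ua) UU0 (dE _ _ (lcos_dcos (lrepK U0))) invgM invgK //.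
rewrite -(fsbig_widen [set U0]) ?fsbig_set1 ?eqxx//=.
  move=> U ->; apply/cosets_inP; rewrite (lcos_dcos (lrepK U0)).
  by rewrite -(dE _ _ e) invgM invgK.
by move=> U [_ /= UU0] /=; case: eqP => // /UU0.
Qed.
End rho.

Section hecke_mulE.
Variables (R : realType) (G : groupType) (H : groupClosed G).
Hypothesis hH : hecke_pair H.

Lemma hecke_mulE (f g : hecke R H) (x : G) :
  hecke_mul hH f g (dcos H x) =
  \sum_(Y \in [set: lcosets H])
    f (dcos H (lrep Y)) * g (dcos H ((lrep Y)^-1 * x)%g).
Proof.
rewrite /= /hecke_conv.
have /dcosP/dcoset_setP[h [k [Hh Hk ->]]] := esym (drepK (dcos H x)).
rewrite (@reindex_fsbigT _ _ _ (lcosets H) (lcosets H)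
  (fun Y => lcos H (h * lrep Y)%g)) /=; last first.
  exists (fun Y => lcos H (h^-1 * lrep Y)%g) => Y.
    by rewrite (lcos_mull h^-1%g (lrepK (lcos H (h * lrep Y)%g))) mulKg lrepK.
  by rewrite (lcos_mull h (lrepK (lcos H (h^-1 * lrep Y)%g))) mulVKg lrepK.
apply: eq_fsbigr => Y _.
have [l Hl ->] := lrep_lcos H (h * lrep Y)%g.
congr (f _ * g _); first by rewrite -mulgA dcos_mulHl// dcos_mulHr.
rewrite !invgM -!mulgA mulKg dcos_mulHl ?gpredV// mulgA dcos_mulHr//.
Qed.

End hecke_mulE.

Definition inner (C : numClosedFieldType) (K : hilbertType C) (xi eta : K) : C :=
  hdot xi eta.

Section operators.
Variable C : numClosedFieldType.
Implicit Types K L T : hilbertType C.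

Definition bounded_op K L (A : K -> L) : Prop := linear A /\ continuous A.

Definition is_adjoint K (A B : K -> K) : Prop :=
  forall xi eta, inner (A xi) eta = inner xi (B eta).

Definition unitary K L (U : K -> L) : Prop :=
  [/\ linear U, forall xi eta, inner (U xi) (U eta) = inner xi eta
    & forall eta, exists xi, U xi = eta].

(* The Hilbert space tensor product is determined up to a unique unitary that
   preserves the elementary tensors: it is a completion of the algebraic tensor
   product for the inner product <k (x) l, k' (x) l'> = <k, k'> <l, l'>. *)
Record hilbert_tensor K L T := HilbertTensor {
  tens :> {bilinear K -> L -> T};
  tens_inner : forall k l k' l',
    inner (tens k l) (tens k' l') = inner k k' * inner l l';
  tens_dense : dense [set v | exists s : seq (K * L), v = \sum_(p <- s) tens p.1 p.2]
}.

(* A = 1 (x) S; by density of the elementary tensors there is at most one bounded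
   operator A with this property. *)
Definition one_tensor_op K L T (t : hilbert_tensor K L T) (S : L -> L) (A : T -> T) :
    Prop :=
  bounded_op A /\ forall k l, A (t k l) = t k (S l).

End operators.

Section representations.
Variable R : realType.
Implicit Types K : hilbertType R[i].

Record c0_rep (X : choiceType) K (nu : c0 R X -> K -> K) : Prop := C0Rep {
  c0_rep_bounded : forall f, bounded_op (nu f);
  c0_rep_linear : forall a f g xi, nu (a *: f + g) xi = a *: nu f xi + nu g xi;
  c0_rep_mul : forall f g xi, nu (c0_mul f g) xi = nu f (nu g xi);
  c0_rep_star : forall f, is_adjoint (nu f) (nu (c0_star f));
  c0_rep_nondegenerate :
    dense [set v | exists s : seq (c0 R X * K), v = \sum_(p <- s) nu p.1 p.2]
}.

Variables (G : groupType) (H : groupClosed G).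

Record hecke_rep (hH : hecke_pair H) K (V : hecke R H -> K -> K) : Prop := HeckeRep {
  hecke_rep_bounded : forall f, bounded_op (V f);
  hecke_rep_linear : forall a f g xi, V (a *: f + g) xi = a *: V f xi + V g xi;
  hecke_rep_mul : forall f g xi, V (hecke_mul hH f g) xi = V f (V g xi);
  hecke_rep_star : forall f, is_adjoint (V f) (V (hecke_star f));
  hecke_rep_unital : forall xi, V (hecke_char R H 1%g) xi = xi
}.

Local Notation eps x := (c0_eps R (lcos H x%g)).
Local Notation dchar a := (hecke_char R H a%g).

Definition upsilon K (nu : c0 R (lcosets H) -> K -> K) (V : hecke R H -> K -> K)
    (x y : G) (xi : K) : K :=
  nu (eps x) (V (dchar (x^-1 * y)) (nu (eps y) xi)).

Definition matrix_unit_pair K (nu : c0 R (lcosets H) -> K -> K)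
    (V : hecke R H -> K -> K) : Prop :=
  let u := upsilon nu V in
  [/\ forall x y, is_adjoint (u x y) (u y x),
      forall x y z xi, u x y (u y z xi) = u x z xi
    & forall x y w z xi, lcos H y <> lcos H w -> u x y (u w z xi) = 0].

Definition covariant_pair K (nu : c0 R (lcosets H) -> K -> K)
    (V : hecke R H -> K -> K) : Prop :=
  forall a x b xi,
    V (dchar a) (nu (eps x) (V (dchar b) xi)) =
    \sum_(U \in cosets_in H a^-1%g) \sum_(W \in cosets_in H b)
      nu (eps (x * lrep U)) (V (dchar ((lrep U)^-1 * lrep W))
        (nu (eps (x * lrep W)) xi)).

Definition c0_equiv K K' (nu : c0 R (lcosets H) -> K -> K)
    (nu' : c0 R (lcosets H) -> K' -> K') : Prop :=
  exists U : K -> K', unitary U /\ forall f xi, U (nu f xi) = nu' f (U xi).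

Definition pair_equiv K K' (nu : c0 R (lcosets H) -> K -> K) (V : hecke R H -> K -> K)
    (nu' : c0 R (lcosets H) -> K' -> K') (V' : hecke R H -> K' -> K') : Prop :=
  exists U : K -> K', [/\ unitary U,
    forall f xi, U (nu f xi) = nu' f (U xi)
    & forall f xi, U (V f xi) = V' f (U xi)].

End representations.

(* Main.v *)
(* Given matrix units u(x,y), the space K decomposes as the Hilbert sum of the
   ranges of the projections u(x,x) = nu(eps_x), each identified with
   K0 = nu(eps_H) K by u(x,H).  So K itself, with k (x) l := sum_x l(x) u(x,H) k,
   is a Hilbert tensor product of K0 and l^2(G/H), on which nu is 1 (x) M; no
   tensor product has to be constructed.  Covariance gives the matrix unit
   relations and nu(eps_z) V(f) = sum_Y f(z^-1 Y) u(z,Y), which is the matrix of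
   1 (x) rho.  Conversely, when nu is a multiple of M this formula defines V: it
   is a finite combination of right translations of G/H, bounded because they have
   finite fibres.  The implications from tensor models to pairs are checked on
   elementary tensors. *)
Require Import Defs.
From HB Require Import structures.
From mathcomp Require Import all_boot all_order all_algebra.
From mathcomp Require Import sesquilinear complex finmap.
From mathcomp Require Import all_classical all_reals.
From mathcomp Require Import topology normedtype.
From mathcomp Require Import summability ring.

Set Implicit Arguments.
Unset Strict Implicit.
Unset Printing Implicit Defensive.

Import Order.TTheory GRing.Theory Num.Theory.
Import numFieldNormedType.Exports.

Local Open Scope classical_set_scope.
Local Open Scope ring_scope.

(** * Hilbert spaces *)

(** Two gaps separate the algebra of matrix units from the Hilbert sum. Nondegeneracy of [nu]
    concerns all of c_0(G/H), while the matrix units only see the point masses, so it must be shown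
    that no nonzero vector is killed by every nu(eps_x). This needs nu(f) to depend continuously on
    f, which is not among the axioms of [c0_rep]; it is derived from positivity by a computation
    that stays inside c_0, where a unit may be missing. The other gap is in the last equivalence:
    there the given model is an arbitrary Hilbert tensor product, known only through elementary
    tensors, and [K0] has to be recovered as the range of 1 (x) M(eps_x), by completeness. Apart
    from this the work is done in coordinates: a vector is determined by its slices in [K0],
    operators are compared slice by slice, and infinite sums occur only in the general theory of
    slices. On slices the Hecke algebra acts by the matrices f(z^-1 Y), whose rows are finite
    because (G,H) is a Hecke pair. *)

Section plain_linear.
Variables (F : nzRingType) (U V : lmodType F) (f : U -> V).
Hypothesis fl : linear f.

Lemma plin0 : f 0 = 0.
Proof. by have := fl (-1) 0 0; rewrite !scaleN1r addNr addNr. Qed.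

Lemma plinD u v : f (u + v) = f u + f v.
Proof. by have := fl 1 u v; rewrite !scale1r. Qed.

Lemma plinZ a u : f (a *: u) = a *: f u.
Proof. by have := fl a u 0; rewrite !addr0 plin0 addr0. Qed.

Lemma plinB u v : f (u - v) = f u - f v.
Proof. by rewrite plinD -scaleN1r plinZ scaleN1r. Qed.

Lemma plin_sum (I : Type) (r : seq I) (P : pred I) (g : I -> U) :
  f (\sum_(i <- r | P i) g i) = \sum_(i <- r | P i) f (g i).
Proof. exact: (big_morph f plinD plin0). Qed.

Lemma plin_fsum (I : choiceType) (D : set I) (g : I -> U) : finite_set D ->
  f (\sum_(i \in D) g i) = \sum_(i \in D) f (g i).
Proof. by move=> fD; rewrite !fsbig_finite// plin_sum. Qed.

End plain_linear.

Section inner_theory.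
Variable R : realType.
Local Notation C := R[i].
Variable K : hilbertType C.
Implicit Types u v w : K.

Lemma innerC u v : inner u v = (inner v u)^*.
Proof. by rewrite /inner hermC expr0 mul1r. Qed.

Lemma inner_linearl w : linear (fun u => inner u w : C^o).
Proof. by move=> a u v; rewrite /inner linearPl. Qed.

Lemma innerDl u v w : inner (u + v) w = inner u w + inner v w.
Proof. exact: linearDl. Qed.

Lemma innerZl a u w : inner (a *: u) w = a * inner u w.
Proof. exact: linearZl_LR. Qed.

Lemma innerDr w u v : inner w (u + v) = inner w u + inner w v.
Proof. by rewrite innerC innerDl rmorphD /= -!innerC. Qed.

Lemma innerZr a w u : inner w (a *: u) = a^* * inner w u.
Proof. by rewrite innerC innerZl rmorphM /= -innerC. Qed.

Lemma inner0r w : inner w 0 = 0.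
Proof. exact: linear0r. Qed.

Lemma innerBl u v w : inner (u - v) w = inner u w - inner v w.
Proof. by rewrite innerDl -scaleN1r innerZl mulN1r. Qed.

Lemma innerBr w u v : inner w (u - v) = inner w u - inner w v.
Proof. by rewrite innerC innerBl rmorphB /= -!innerC. Qed.

Lemma inner_suml (I : Type) (r : seq I) (P : pred I) (g : I -> K) w :
  inner (\sum_(i <- r | P i) g i) w = \sum_(i <- r | P i) inner (g i) w.
Proof. exact: (plin_sum (inner_linearl w)). Qed.

Lemma inner_sumr (I : Type) (r : seq I) (P : pred I) (g : I -> K) w :
  inner w (\sum_(i <- r | P i) g i) = \sum_(i <- r | P i) inner w (g i).
Proof.
by rewrite innerC inner_suml rmorph_sum; apply: eq_bigr => i _; rewrite [RHS]innerC.
Qed.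

Lemma innerxx u : inner u u = `|u| ^+ 2.
Proof. exact: hdotxx. Qed.

Lemma inner_eq0 u : inner u u = 0 -> u = 0.
Proof. by rewrite innerxx => /eqP; rewrite sqrf_eq0 normr_eq0 => /eqP. Qed.

Lemma inner_inj u v : (forall w, inner u w = inner v w) -> u = v.
Proof.
by move=> uv; apply/eqP; rewrite -subr_eq0; apply/eqP/inner_eq0; rewrite innerBl uv subrr.
Qed.

Lemma inner_CauchySchwarz u v : `|inner u v| <= `|u| * `|v|.
Proof.
rewrite -(ler_pXn2r (n := 2)) ?nnegrE ?mulr_ge0// exprMn -!innerxx.
exact: dot_CS.
Qed.

End inner_theory.

Section linear_continuity.
Variable R : realType.
Local Notation C := R[i].

Lemma lipschitz_continuous (V W : normedModType C) (f : V -> W) (M : C) :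
  0 <= M -> linear f -> (forall v, `|f v| <= M * `|v|) -> continuous f.
Proof.
move=> M0 fl fM v; apply/cvgrPdist_lt => e e0.
have M1 : 0 < M + 1 by rewrite ltr_wpDl.
near=> w; rewrite -(plinB fl); apply: (le_lt_trans (fM _)).
apply: (@le_lt_trans _ _ ((M + 1) * `|v - w|)); first by rewrite ler_wpM2r// lerDl.
rewrite mulrC -ltr_pdivlMr//; near: w.
by apply: (@cvgr_dist_lt _ _ _ (nbhs v) _ id v cvg_id); rewrite divr_gt0.
Unshelve. all: by end_near. Qed.

Lemma inner_continuousl (K : hilbertType C) (w : K) :
  continuous (fun v => inner v w : C^o).
Proof.
apply: (lipschitz_continuous (normr_ge0 w) (inner_linearl w)) => v.
by rewrite mulrC inner_CauchySchwarz.
Qed.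

Lemma inner_continuousr (K : hilbertType C) (w : K) :
  continuous (fun v => inner w v : C^o).
Proof.
move=> v; rewrite /continuous_at innerC; under eq_fun do rewrite innerC.
exact: cvg_conj (@inner_continuousl K w v).
Qed.

Lemma dense_ext (T : topologicalType) (W : normedModType C) (D : set T) (f g : T -> W) :
  dense D -> continuous f -> continuous g -> (forall x, D x -> f x = g x) -> f =1 g.
Proof.
move=> dD fc gc fg x; apply: contrapT => ne.
have e0 : 0 < `|f x - g x| / 2.
  by rewrite divr_gt0// normr_gt0 subr_eq0; apply/eqP.
have [U [oU Ux UP]] : exists U : set T, [/\ open U, U x &
    forall y, U y -> `|f x - f y| < `|f x - g x| / 2 /\ `|g x - g y| < `|f x - g x| / 2].
  have : nbhs x (fun y => `|f x - f y| < `|f x - g x| / 2 /\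
                          `|g x - g y| < `|f x - g x| / 2).
    move/cvgrPdist_lt: (fc x) => /(_ _ e0); move/cvgrPdist_lt: (gc x) => /(_ _ e0).
    by move=> gx fx; exact: filterI.
  by rewrite nbhsE => -[U [oU Ux] UP]; exists U.
have [y [Uy Dy]] := dD U (ex_intro _ x Ux) oU.
have [fy gy] := UP _ Uy.
have := le_lt_trans (ler_distD (f y) (f x) (g x)).
by rewrite {2}(fg _ Dy) (distrC (g y)) => /(_ _ (ltrD fy gy)); rewrite -splitr ltxx.
Qed.

End linear_continuity.

(* Equivalently, [v |-> (s x v)_x] identifies [K] with the Hilbert direct sum of
   copies of [K0] indexed by [X], and [J x] is the inclusion of the x-th summand. *)
Record slicing (R : realType) (X : choiceType) (K0 K : hilbertType R[i])
    (J : X -> K0 -> K) (s : X -> K -> K0) : Prop := Slicing {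
  slice_adj : forall x k v, inner (J x k) v = inner k (s x v);
  sliceJ : forall x y k, s x (J y k) = (x == y)%:R *: k;
  slice_total : forall v, (forall x, s x v = 0) -> v = 0
}.

(** * Coordinates in an orthogonal decomposition into copies of one space *)

Section slicing_theory.
Variables (R : realType) (X : choiceType).
Local Notation C := R[i].
Variables (K0 K : hilbertType C) (J : X -> K0 -> K) (s : X -> K -> K0).
Hypothesis sl : slicing J s.

#[local] Existing Instance totally_filter.

(** Linearity comes from the adjunction: the numbers <w, s x v> = <J x w, v> determine [s x v]. *)
Lemma slice_linear x : linear (s x).
Proof.
move=> a u v; apply: inner_inj => w; rewrite innerDl innerZl ![inner (s x _) _]innerC.
by rewrite -!(slice_adj sl) innerDr innerZr rmorphD rmorphM /= conjCK -!innerC.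
Qed.

Lemma slicing_incl_inner x y k k' : inner (J x k) (J y k') = (x == y)%:R * inner k k'.
Proof. by rewrite (slice_adj sl) (sliceJ sl) innerZr conjC_nat. Qed.

Lemma norm_slicing_incl x k : `|J x k| = `|k|.
Proof.
apply/eqP; rewrite -(eqrXn2 (n := 2))// -!innerxx.
by rewrite slicing_incl_inner eqxx mul1r.
Qed.

Lemma slice_continuous x : continuous (s x).
Proof.
apply: (lipschitz_continuous ler01 (slice_linear x)) => v; rewrite mul1r.
have [->|nz] := eqVneq (s x v) 0; first by rewrite normr0.
rewrite -(ler_pM2l (_ : 0 < `|s x v|)) ?normr_gt0//.
(* |s x v|^2 = <J x (s x v), v>, and [J x] is isometric, so Cauchy-Schwarz gives |s x v| <= |v|. *)
apply: (@le_trans _ _ `|inner (J x (s x v)) v|).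
  by rewrite (slice_adj sl) innerxx expr2 normrM !normr_id.
by rewrite -(norm_slicing_incl x (s x v)) inner_CauchySchwarz.
Qed.

Lemma slice_ext v w : (forall x, s x v = s x w) -> v = w.
Proof.
move=> vw; apply/eqP; rewrite -subr_eq0; apply/eqP/(slice_total sl) => x.
by rewrite (plinB (slice_linear x)) vw subrr.
Qed.

Lemma slice_sum x (A : {fset X}) (k : X -> K0) :
  s x (\sum_(y <- A) J y (k y)) = if x \in A then k x else 0.
Proof.
rewrite (plin_sum (slice_linear x)); under eq_bigr do rewrite (sliceJ sl).
case: ifPn => xA.
  rewrite (big_fsetD1 x)//= eqxx scale1r big_seq big1 ?addr0// => y.
  by rewrite !inE eq_sym => /andP[/negbTE -> _]; rewrite scale0r.
rewrite big_seq big1// => y yA.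
by case: eqP yA xA => [-> ->|] //; rewrite scale0r.
Qed.

Lemma inner_slicing_sum (A : {fset X}) (k : X -> K0) v :
  inner (\sum_(y <- A) J y (k y)) v = \sum_(y <- A) inner (k y) (s y v).
Proof. by rewrite inner_suml; under eq_bigr do rewrite (slice_adj sl). Qed.

Lemma norm_slicing_sum (P : pred X) (A : {fset X}) (k : X -> K0) :
  `|\sum_(y <- A | P y) J y (k y)| ^+ 2 = \sum_(y <- A | P y) `|k y| ^+ 2.
Proof.
rewrite big_fset_condE [RHS]big_fset_condE -innerxx inner_slicing_sum big_seq [RHS]big_seq.
by apply: eq_bigr => y yA; rewrite slice_sum yA innerxx.
Qed.

Definition square_summable (k : X -> K0) :=
  exists M : C, forall A : {fset X}, \sum_(x <- A) `|k x| ^+ 2 <= M.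

(** By Pythagoras the squared norm of a finite tail is the tail of the sum of the |k x|^2, so the
    partial sums are Cauchy; continuity of [s x] then identifies the slices of the limit. *)
Lemma slicing_sum_cvg (k : X -> K0) : square_summable k ->
  exists2 v, forall x, s x v = k x & partial_sum (fun x => J x (k x)) @ totally --> v.
Proof.
move=> [M kM]; have FF : ProperFilter (@totally X) := totally_filter.
have cS : cvg (partial_sum (fun x => J x (k x)) @ totally).
  apply: cauchy_cvg; apply/cauchy_exP => e e0.
  have /cvg_ex[/= l kl] : cvg (partial_sum (fun x => `|k x| ^+ 2 : C^o) @ totally).
    apply: (@partial_sum_cvg _ _ _ M) => A.
    by under eq_bigr do rewrite normrX normr_id.
  (* The sums of squares over A and over B both lie within e^2/2 of their limit, so the squared tail
     over B minus A is below e^2. *)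
  have e2 : 0 < e ^+ 2 / 2 by rewrite divr_gt0// exprn_gt0.
  move/cvgrPdist_lt: kl => /(_ _ e2)[A _ Al].
  exists (partial_sum (fun x => J x (k x)) A); exists A => // B /= AB.
  rewrite -ball_normE /= distrC !partial_sumE (sum_fset_sub _ AB) addrAC subrr add0r.
  rewrite -(ltr_pXn2r (n := 2)) ?nnegrE ?(ltW e0)// norm_slicing_sum.
  have := ltrD (Al B AB) (Al A (fsubset_refl A)).
  rewrite /= -splitr distrC => /(le_lt_trans (ler_distD _ _ _)).
  rewrite !partial_sumE (sum_fset_sub _ AB) addrAC subrr add0r.
  by rewrite ger0_norm// sumr_ge0// => x _; rewrite exprn_ge0.
have /cvg_ex[/= v Sv] := cS; exists v => // x.
have sv : s x \o partial_sum (fun x => J x (k x)) @ totally --> s x v.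
  exact: (cvg_comp _ _ Sv (@slice_continuous x v)).
apply: (cvg_unique (@norm_hausdorff _ _) sv); apply: cvg_near_cst.
exists [fset x]%fset => // A /= xA; rewrite partial_sumE slice_sum.
by rewrite (fsubsetP xA)// inE.
Qed.

Lemma slice_bessel v (A : {fset X}) : \sum_(x <- A) `|s x v| ^+ 2 <= `|v| ^+ 2.
Proof.
(* [w] is the orthogonal projection of [v] to the summands in [A]: from <w, v> = |w|^2 and
   Cauchy-Schwarz, |w| <= |v|. *)
set w := \sum_(x <- A) J x (s x v).
have wv : inner w v = `|w| ^+ 2.
  by rewrite inner_slicing_sum norm_slicing_sum; under eq_bigr do rewrite innerxx.
have [w0|w0] := eqVneq w 0.
  by rewrite -norm_slicing_sum -/w w0 normr0 expr0n exprn_ge0.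
rewrite -norm_slicing_sum -/w lerXn2r ?nnegrE//.
rewrite -(ler_pM2l (_ : 0 < `|w|)) ?normr_gt0// -expr2.
by have := inner_CauchySchwarz w v; rewrite wv normrX normr_id.
Qed.

Lemma slice_square_summable v : square_summable (s^~ v).
Proof. by exists (`|v| ^+ 2); exact: slice_bessel. Qed.

Lemma slicing_cvg v : partial_sum (fun x => J x (s x v)) @ totally --> v.
Proof.
have [w wv] := slicing_sum_cvg (slice_square_summable v).
by rewrite (slice_ext wv).
Qed.

Lemma slicing_dense (D : set K) :
  D 0 -> (forall a u v, D u -> D v -> D (a *: u + v)) -> (forall x k, D (J x k)) -> dense D.
Proof.
move=> D0 Dlin DJ U [v Uv] oU.
have FF : ProperFilter (@totally X) := totally_filter.
have [A UA] : exists A, U (partial_sum (fun x => J x (s x v)) A).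
  have UF := @slicing_cvg v U (open_nbhs_nbhs (conj oU Uv)).
  exact: (@filter_ex _ (@totally X) FF _ UF).
exists (partial_sum (fun x => J x (s x v)) A); split=> //.
rewrite partial_sumE; elim: (enum_fset A) => [|x r IH]; rewrite ?big_nil// big_cons.
by rewrite -[J _ _]scale1r; exact: Dlin.
Qed.

(** Parseval: continuity of the inner product is applied to the expansion of [u] only. *)
Lemma inner_slices u v :
  partial_sum (fun x => inner (s x u) (s x v) : C^o) @ totally --> (inner u v : C^o).
Proof.
have := cvg_comp _ _ (@slicing_cvg u) (@inner_continuousl _ _ v u).
apply: cvg_trans; apply: near_eq_cvg; apply: nearW => A /=.
by rewrite !partial_sumE inner_slicing_sum.
Qed.

Lemma slicing_norm_ler v (M : C) : 0 <= M ->
  (forall A : {fset X}, \sum_(x <- A) `|s x v| ^+ 2 <= M ^+ 2) -> `|v| <= M.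
Proof.
move=> M0 vM; rewrite -(ler_pXn2r (n := 2)) ?nnegrE// -innerxx.
have FF : ProperFilter (@totally X) := totally_filter.
apply: (@lim_le R _ _ FF _ _ (M ^+ 2 : C^o) (inner_slices (u := v) (v := v))); apply: filterE => A.
by rewrite partial_sumE; under eq_bigr do rewrite innerxx.
Qed.

(* The junk value on families that are not square summable is [0]. *)
Definition of_slices (k : X -> K0) : K := xget 0 [set v | forall x, s x v = k x].

Lemma of_slicesK (k : X -> K0) x : square_summable k -> s x (of_slices k) = k x.
Proof.
move=> /slicing_sum_cvg[v vk _]; rewrite /of_slices.
by case: xgetP => [w _ -> //|/(_ v)].
Qed.

End slicing_theory.

(** * The tensor product carried by a slicing *)

Section slicing_tensor.
Variables (R : realType) (X : choiceType).
Local Notation C := R[i].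
Variables (K0 K : hilbertType C) (J : X -> K0 -> K) (s : X -> K -> K0).
Hypothesis sl : slicing J s.

#[local] Existing Instance totally_filter.

(** Given by its slices, so that bilinearity is checked slice by slice; the family is square
    summable because [l] is. *)
Definition slicing_tens (k : K0) (l : ell2 R X) : K := of_slices s (fun x => l x *: k).

Lemma slice_tens k l x : s x (slicing_tens k l) = l x *: k.
Proof.
apply: (of_slicesK sl); have [M lM] := ell2P l.
exists (M * `|k| ^+ 2) => A.
under eq_bigr do rewrite normrZ exprMn.
by rewrite -mulr_suml ler_wpM2r ?exprn_ge0.
Qed.

Fact slicing_tens_bilinear :
  bilinear_for (GRing.Scale.Law.clone _ _ ( *:%R : C -> K -> K) _)
    (GRing.Scale.Law.clone _ _ ( *:%R : C -> K -> K) _) slicing_tens.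
Proof.
have sD x := plinD (slice_linear sl x); have sZ x := plinZ (slice_linear sl x).
split=> [l a k k'|k a l l']; apply: (slice_ext sl) => x; rewrite sD sZ !slice_tens.
  by rewrite scalerDr !scalerA mulrC.
by rewrite /= scalerDl scalerA.
Qed.

Lemma slicing_tensE x k : slicing_tens k (ell2_eps R x) = J x k.
Proof.
by apply: (slice_ext sl) => y; rewrite slice_tens (sliceJ sl).
Qed.

Lemma slicing_tens_inner k l k' l' :
  inner (slicing_tens k l) (slicing_tens k' l') = inner k k' * inner l l'.
Proof.
have c1 : partial_sum (fun x => inner (s x (slicing_tens k l)) (s x (slicing_tens k' l')) : C^o)
    @ totally --> (inner k k' * inner l l' : C^o).
  rewrite (_ : partial_sum _ =
      inner k k' \*: partial_sum (fun x => l x * (l' x)^* : C^o)); last first.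
    apply/funext => A; rewrite /= !partial_sumE scaler_sumr; apply: eq_bigr => x _.
    by rewrite !slice_tens innerZl innerZr mulrA [RHS]mulrC.
  have FF : ProperFilter (@totally X) := totally_filter.
  exact: (@cvgZl_tmp C C^o _ _ _ (inner k k') _ _ (@ell2_dot_cvg _ _ l l')).
exact: (cvg_unique (@norm_hausdorff _ C^o) (@inner_slices _ _ _ _ _ _ sl _ _) c1).
Qed.

Lemma slicing_tensor : exists t : hilbert_tensor K0 (ell2 R X) K,
  forall k l x, s x (t k l) = l x *: k.
Proof.
pose b : {bilinear K0 -> ell2 R X -> K} := HB.pack slicing_tens
  (bilinear_isBilinear.Build C K0 (ell2 R X) K _ _ slicing_tens slicing_tens_bilinear).
have dense_tens : dense [set v | exists r : seq (K0 * ell2 R X), v = \sum_(p <- r) b p.1 p.2].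
  apply: (slicing_dense sl) => [|a u v [r ->] [r' ->]|x k].
  - by exists [::]; rewrite big_nil.
  - exists ([seq (a *: p.1, p.2) | p <- r] ++ r').
    rewrite big_cat big_map /= scaler_sumr; congr (_ + _).
    apply: eq_bigr => p _; apply: (slice_ext sl) => x.
    by rewrite (plinZ (slice_linear sl x)) /= !slice_tens !scalerA mulrC.
  - by exists [:: (k, ell2_eps R x)]; rewrite big_seq1 /= slicing_tensE.
by exists (@HilbertTensor _ _ _ _ b slicing_tens_inner dense_tens) => k l x; exact: slice_tens.
Qed.

End slicing_tensor.

(** * The Hilbert space of fixed vectors of a bounded operator *)

Section fixed_space.
Variables (R : realType) (K : hilbertType R[i]) (P : K -> K).
Hypothesis Pb : bounded_op P.

(** For a projection this is its range; described by an equation, it is closed because [P] is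
    continuous, and hence complete. *)
Definition fixed_pred : {pred K} := fun v => P v == v.

Fact fixed_submod_closed : subsemimod_closed fixed_pred.
Proof.
have [Pl _] := Pb; split; first split.
- by rewrite unfold_in (plin0 Pl).
- move=> u v; rewrite !unfold_in => /eqP Pu /eqP Pv.
  by rewrite (plinD Pl) Pu Pv.
- by move=> a u; rewrite !unfold_in => /eqP Pu; rewrite (plinZ Pl) Pu.
Qed.

HB.instance Definition _ :=
  GRing.isSubmodClosed.Build R[i] K fixed_pred fixed_submod_closed.

Record fixed_space := MkFixed { fixed_val :> K; _ : fixed_val \in fixed_pred }.
HB.instance Definition _ := [isSub for fixed_val].
HB.instance Definition _ := [Choice of fixed_space by <:].
HB.instance Definition _ := [SubChoice_isSubLmodule of fixed_space by <:].

Definition fixed_dot (u v : fixed_space) : R[i] := inner (val u) (val v).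

Fact fixed_dot_bilinear :
  bilinear_for (GRing.Scale.Law.clone _ _ ( *%R : R[i] -> R[i] -> R[i]) _)
    (GRing.Scale.Law.clone _ _ (Num.conj \; *%R) _) fixed_dot.
Proof.
split=> [w a u v|w a u v]; rewrite /fixed_dot linearP; first exact: inner_linearl.
by rewrite innerDr innerZr.
Qed.

Fact fixed_dotC u v : fixed_dot u v = (-1) ^+ false * (fixed_dot v u)^*.
Proof. by rewrite expr0 mul1r /fixed_dot innerC. Qed.

Fact fixed_dot_gt0 u : u != 0 -> 0 < fixed_dot u u.
Proof. by move=> u0; rewrite /fixed_dot innerxx exprn_gt0// normr_gt0. Qed.

HB.instance Definition _ := bilinear_isBilinear.Build R[i] fixed_space fixed_space R[i]
  _ _ fixed_dot fixed_dot_bilinear.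
HB.instance Definition _ := isHermitianSesquilinear.Build R[i] fixed_space false Num.conj
  fixed_dot fixed_dotC.
HB.instance Definition _ := isDotProduct.Build R[i] fixed_space fixed_dot fixed_dot_gt0.

Let dot : {dot fixed_space for Num.conj} := fixed_dot.

HB.instance Definition _ := @Lmodule_isNormed.Build R[i] fixed_space
  (dot_norm dot) (@dot_normD _ _ dot) (@dot_normZ _ _ dot) (@dot_norm_eq0 _ _ dot).

Lemma fixed_norm_sq (u : fixed_space) : `|u| ^+ 2 = fixed_dot u u.
Proof. exact: (dot_normK dot). Qed.

Lemma norm_fixed (u : fixed_space) : `|u| = `|val u|.
Proof.
by apply/eqP; rewrite -(eqrXn2 (n := 2))// fixed_norm_sq /fixed_dot innerxx.
Qed.

Lemma fixed_complete (F : set_system fixed_space) : ProperFilter F -> cauchy F -> cvg F.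
Proof.
move=> FF /cauchyP Fc; have [_ Pc] := Pb.
have /cvg_ex[/= v Fv] : cvg (val @ F : set_system K).
  apply: cauchy_cvg; apply/cauchy_exP => e /Fc[u Fu]; exists (val u).
  rewrite /nbhs /= /fmap /=; apply: filterS Fu => w.
  by rewrite -!ball_normE /= norm_fixed raddfB.
have Pv : P v = v.
  apply: (cvg_unique (@norm_hausdorff _ K) (F := val @ F) _ Fv).
  apply: cvg_trans (cvg_comp _ _ Fv (Pc v)); apply: near_eq_cvg; apply: nearW => u /=.
  by have /eqP := valP u.
have Fv' : v \in fixed_pred by apply/eqP.
apply/cvg_ex; exists (MkFixed Fv'); apply/cvgrPdist_lt => e e0.
move/cvgrPdist_lt: Fv => /(_ _ e0); apply: filterS => u.
by rewrite norm_fixed raddfB.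
Qed.

HB.instance Definition _ := Uniform_isComplete.Build fixed_space fixed_complete.

HB.instance Definition _ := isHilbert.Build R[i] fixed_space
  (fun u => esym (fixed_norm_sq u) : dot u u = `|u| ^+ 2).

Definition fixed_hilbert : hilbertType R[i] := fixed_space.

Lemma fixed_spaceP : exists (K0 : hilbertType R[i]) (iota : K0 -> K),
  [/\ linear iota, forall u v, inner (iota u) (iota v) = inner u v &
      forall v, P v = v <-> exists u, iota u = v].
Proof.
exists fixed_hilbert, fixed_val; split=> // v; split=> [Pv|[u <-]]; last exact/eqP/(valP u).
have Pv' : v \in fixed_pred by apply/eqP.
by exists (MkFixed Pv').
Qed.

End fixed_space.

(** * Representations of c_0 *)

Section c0_rep_theory.
Variables (R : realType) (X : choiceType).
Local Notation C := R[i].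
Implicit Types (f g : c0 R X) (x y : X).

Lemma c0_ext f g : (forall x, f x = g x) -> f = g.
Proof. by move=> fg; apply/val_inj/funext. Qed.

Lemma c0_mul_epsr f x : c0_mul f (c0_eps R x) = f x *: c0_eps R x.
Proof.
apply: c0_ext => y /=; rewrite -[RHS]/(f x * (y == x)%:R).
by case: eqP => [->|] //; rewrite !mulr0.
Qed.

Lemma c0_mulC f g : c0_mul f g = c0_mul g f.
Proof. by apply: c0_ext => y /=; rewrite mulrC. Qed.

Lemma c0_star_eps x : c0_star (c0_eps R x) = c0_eps R x.
Proof. by apply: c0_ext => y /=; rewrite conjC_nat. Qed.

Variables (K : hilbertType C) (nu : c0 R X -> K -> K).
Hypothesis hnu : c0_rep nu.
Implicit Types v w : K.

Lemma c0_rep_linearv f : linear (nu f).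
Proof. by case: (c0_rep_bounded hnu f). Qed.

Lemma c0_repZ a f v : nu (a *: f) v = a *: nu f v.
Proof. exact: (plinZ (fun a f g => c0_rep_linear hnu a f g v)). Qed.

Lemma c0_repD f g v : nu (f + g) v = nu f v + nu g v.
Proof. exact: (plinD (fun a f g => c0_rep_linear hnu a f g v)). Qed.

Lemma c0_rep_sum (I : Type) (r : seq I) (f : I -> c0 R X) v :
  nu (\sum_(i <- r) f i) v = \sum_(i <- r) nu (f i) v.
Proof. exact: (plin_sum (fun a f g => c0_rep_linear hnu a f g v)). Qed.

Lemma c0_rep_epsr f x v : nu f (nu (c0_eps R x) v) = f x *: nu (c0_eps R x) v.
Proof. by rewrite -(c0_rep_mul hnu) c0_mul_epsr c0_repZ. Qed.

Lemma c0_rep_epsl f x v : nu (c0_eps R x) (nu f v) = f x *: nu (c0_eps R x) v.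
Proof. by rewrite -(c0_rep_mul hnu) c0_mulC c0_mul_epsr c0_repZ. Qed.

Lemma c0_rep_eps x y v :
  nu (c0_eps R x) (nu (c0_eps R y) v) = (x == y)%:R *: nu (c0_eps R y) v.
Proof. by rewrite c0_rep_epsr /= eq_sym. Qed.

Lemma c0_rep_eps_adj x : is_adjoint (nu (c0_eps R x)) (nu (c0_eps R x)).
Proof. by rewrite -{2}c0_star_eps; exact: c0_rep_star. Qed.

(* With [h = e - sqrt (e^2 - |g|^2)] one has [e^2 - g^* g = (e - h)^2], so
   [e^2 |v|^2 - |nu g v|^2 = |e v - nu h v|^2 >= 0]. *)
Lemma c0_rep_contractive g e v : 0 < e -> (forall x, `|g x| <= e) ->
  `|nu g v| <= e * `|v|.
Proof.
move=> e0 ge; pose r x : C := sqrtC (e ^+ 2 - `|g x| ^+ 2); pose h x : C := e - r x.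
have d0 x : 0 <= e ^+ 2 - `|g x| ^+ 2.
  by rewrite subr_ge0 lerXn2r ?nnegrE// ltW.
have r0 x : 0 <= r x by rewrite sqrtC_ge0.
have rr x : r x ^+ 2 = e ^+ 2 - `|g x| ^+ 2 by rewrite sqrtCK.
have re x : r x <= e.
  by rewrite -(ler_pXn2r (n := 2)) ?nnegrE ?(ltW e0)// rr gerBl exprn_ge0.
have h0 x : 0 <= h x by rewrite subr_ge0.
(* Where g tends to 0 the root [r] tends to e, so it need not lie in c_0. The difference [h = e - r]
   does: |g|^2 = (e + r) h >= e h, so h is small wherever g is. *)
have hg x : e * h x <= `|g x| ^+ 2.
  have -> : `|g x| ^+ 2 = (e + r x) * h x by rewrite /h mulrC -subr_sqr rr opprB addrC subrK.
  by rewrite ler_wpM2r// lerDl.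
have hc0 : (h : X -> C^o) \in @c0_pred R X.
  apply/asboolP => d d0'; have ed : 0 < sqrtC (e * d) by rewrite sqrtC_gt0 mulr_gt0.
  apply: sub_finite_set (c0P g ed) => x /=; rewrite (ger0_norm (h0 x)) => dh.
  rewrite -(ler_pXn2r (n := 2)) ?nnegrE ?(ltW ed)// sqrtCK.
  by apply: le_trans (hg x); rewrite ler_pM2l.
pose H : c0 R X := MkC0 hc0.
have HS : c0_star H = H.
  by apply: c0_ext => x /=; apply/CrealP; rewrite ger0_real.
have gH : c0_mul (c0_star g) g = (2 * e) *: H - c0_mul H H.
  apply: c0_ext => x; rewrite -[RHS]/(2 * e * h x - h x * h x) /=.
  have -> : (g x)^* * g x = `|g x| ^+ 2 by rewrite mulrC -normCK.
  have := rr x => /eqP; rewrite eq_sym subr_eq => /eqP.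
  have -> : r x = e - h x by rewrite /h opprB addrC subrK.
  move=> er; have -> : `|g x| ^+ 2 = e ^+ 2 - (e - h x) ^+ 2 by rewrite er addrAC subrr add0r.
  by ring.
rewrite -(ler_pXn2r (n := 2)) ?nnegrE ?mulr_ge0 ?(ltW e0)// -subr_ge0 exprMn.
rewrite (_ : _ - _ = `|e *: v - nu H v| ^+ 2) ?exprn_ge0//.
have eR : e^* = e by apply/CrealP; rewrite gtr0_real.
have HvC : inner v (nu H v) = inner (nu H v) v by rewrite (c0_rep_star hnu) HS.
have gHv : nu (c0_star g) (nu g v) = (2 * e) *: nu H v - nu H (nu H v).
  by rewrite -!(c0_rep_mul hnu) gH -scaleN1r c0_repD !c0_repZ scaleN1r.
rewrite -!innerxx (c0_rep_star hnu) gHv.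
rewrite innerBr !innerZr innerBl !innerBr !innerZl !innerZr.
rewrite rmorphM /= eR conjC_nat HvC.
rewrite [inner (nu H v) (nu H v)](c0_rep_star hnu) HS.
by ring.
Qed.

(** Cutting f off to the finite set where |f| >= d leaves a remainder bounded by d, and [nu] of the
    cut-off part kills v. By [c0_rep_contractive], nu(f) v = 0 for all f, so v is orthogonal to the
    dense span of the nu(f) w. *)
Lemma c0_rep_total v : (forall x, nu (c0_eps R x) v = 0) -> v = 0.
Proof.
move=> v0.
have nuv0 f : nu f v = 0.
  apply/eqP; rewrite -normr_eq0; apply/eqP/le_anti; rewrite normr_ge0 andbT.
  apply/ler_addgt0Pl => e e0; rewrite addr0.
  have v1 : 0 < `|v| + 1 by rewrite ltr_wpDl.
  (* This choice gives d |v| <= e, also when v = 0. *)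
  pose d := e / (`|v| + 1); have d0 : 0 < d by rewrite divr_gt0.
  pose A := fset_set [set x | d <= `|f x|].
  pose g := f - \sum_(x <- A) f x *: c0_eps R x.
  have gE x : g x = if x \in A then 0 else f x.
    rewrite -[LHS]/(f x - val (\sum_(x <- A) f x *: c0_eps R x) x) raddf_sum fct_sumE.
    rewrite (eq_bigr (fun y => f y * (x == y)%:R))//.
    case: ifPn => xA.
      rewrite (big_fsetD1 x)//= eqxx mulr1 big_seq big1 ?addr0 ?subrr// => y.
      by rewrite !inE eq_sym => /andP[/negbTE -> _]; rewrite mulr0.
    rewrite big_seq big1 ?subr0// => y yA.
    by case: eqP yA xA => [->->|]; rewrite ?mulr0.
  have -> : nu f v = nu g v.
    have {1}-> : f = g + \sum_(x <- A) f x *: c0_eps R x by rewrite /g subrK.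
    rewrite c0_repD c0_rep_sum big1 ?addr0// => x _.
    by rewrite c0_repZ v0 scaler0.
  apply: le_trans (c0_rep_contractive v d0 _) _ => [x|].
    rewrite gE; case: ifPn; first by rewrite normr0 ltW.
    rewrite in_fset_set; last exact: c0P.
    by rewrite notin_setE /= => /negP; rewrite -real_ltNge ?normr_real ?(gtr0_real d0)// => /ltW.
  by rewrite /d mulrAC ler_pdivrMr// ler_pM2l// lerDl.
have : (fun w => inner v w : C^o) =1 (fun=> 0).
  apply: (dense_ext (c0_rep_nondegenerate hnu)); [exact: inner_continuousr|exact: cst_continuous|].
  move=> w [r ->]; rewrite inner_sumr big1// => p _.
  by rewrite innerC (c0_rep_star hnu) nuv0 inner0r conjC0.
by move=> /(_ v)/inner_eq0.
Qed.

End c0_rep_theory.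

(** * The Hecke algebra acting on families indexed by G/H *)

Section hecke_action.
Variables (R : realType) (G : groupType) (H : groupClosed G).
Hypothesis hH : hecke_pair H.
Local Notation C := R[i].
Local Notation X := (lcosets H).
Implicit Types (f g : hecke R H) (x y z : G) (U : lmodType C).

Lemma dcos_lrepr x y : dcos H (x * lrep (lcos H y))%g = dcos H (x * y)%g.
Proof. by have [h Hh ->] := lrep_lcos H y; rewrite mulgA (dcos_mulHr _ Hh). Qed.

Lemma dcos_lrepl x y : dcos H ((lrep (lcos H x))^-1 * y)%g = dcos H (x^-1 * y)%g.
Proof. by have [h Hh ->] := lrep_lcos H x; rewrite invgM -mulgA dcos_mulHl ?gpredV. Qed.

Lemma dcos_mulVl z z' y : lcos H z = lcos H z' ->
  dcos H (z^-1 * y)%g = dcos H (z'^-1 * y)%g.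
Proof. by move=> zz'; rewrite -(dcos_lrepl z y) zz' (dcos_lrepl z' y). Qed.

Lemma hecke_ext f g : (forall x, f (dcos H x) = g (dcos H x)) -> f = g.
Proof. by move=> fg; apply/val_inj/funext => d; rewrite -(drepK d); exact: fg. Qed.

Lemma hecke_charE x y : hecke_char R H x (dcos H y) = (dcos H y == dcos H x)%:R.
Proof. by []. Qed.

Lemma hecke_char_dcos x y : dcos H x = dcos H y -> hecke_char R H x = hecke_char R H y.
Proof. by move=> xy; apply: hecke_ext => z; rewrite !hecke_charE xy. Qed.

Lemma hecke_char_inv x y :
  hecke_char R H x^-1%g (dcos H y) = hecke_char R H x (dcos H y^-1%g).
Proof.
rewrite !hecke_charE (_ : (_ == _) = (dcos H y^-1%g == dcos H x))//.
by apply/eqP/eqP => /dcos_inv; rewrite invgK.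
Qed.

Lemma hecke_star_char x : hecke_star (hecke_char R H x) = hecke_char R H x^-1%g.
Proof.
by apply: hecke_ext => y; rewrite hecke_starE hecke_char_inv hecke_charE conjC_nat.
Qed.

(** Covariance only speaks of characteristic functions of double cosets; this carries its
    consequences over to every f. *)
Lemma hecke_ind (P : hecke R H -> Prop) :
  P 0 -> (forall a f g, P f -> P g -> P (a *: f + g)) ->
  (forall x, P (hecke_char R H x)) -> forall f, P f.
Proof.
move=> P0 Plin Pc f; pose A := fset_set [set d | f d != 0].
have -> : f = \sum_(d <- A) f d *: hecke_char R H (drep d).
  apply: hecke_ext => x.
  rewrite -[RHS]/(val (\sum_(d <- A) f d *: hecke_char R H (drep d)) (dcos H x)).
  rewrite raddf_sum fct_sumE.
  rewrite (eq_bigr (fun d => f d * (dcos H x == d)%:R)) => [|d _]; last first.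
    by rewrite -[X in (_ == X)%:R](drepK d).
  have [fx|fx] := eqVneq (f (dcos H x)) 0.
    by rewrite fx big1// => d _; case: eqP => [<-|]; rewrite ?fx ?mul0r ?mulr0.
  have xA : dcos H x \in A by rewrite in_fset_set ?inE//; exact: heckeP.
  rewrite (big_fsetD1 _ xA)/= eqxx mulr1 big_seq big1 ?addr0// => d.
  by rewrite !inE eq_sym => /andP[/negbTE -> _]; rewrite mulr0.
elim: (enum_fset A) => [|d r IH]; rewrite ?big_nil// big_cons; exact: Plin.
Qed.

Lemma hecke_kernel_finite f z : finite_set [set Y : X | f (dcos H (z^-1 * lrep Y)%g) != 0].
Proof.
apply: sub_finite_set (finite_image (fun W => lcos H (z * lrep W)%g) (hecke_supp_finite hH f)).
move=> Y /= fY; exists (lcos H (z^-1 * lrep Y)%g).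
  by rewrite /= -[lrep _]mul1g dcos_lrepr mul1g.
by rewrite (lcos_mull z (lrepK _)) mulVKg lrepK.
Qed.

(* The extension of [rho] to families indexed by G/H with values in any vector space. *)
Definition hecke_act U f (F : X -> U) (z : G) : U :=
  \sum_(Y \in [set: X]) f (dcos H (z^-1 * lrep Y)%g) *: F Y.

(** A sum over all of G/H has the value 0 by convention when its support is infinite, so sums are
    moved to an explicit set, taken finite, before they are split or exchanged. *)
Lemma hecke_act_widen U f (F : X -> U) z (B : set X) :
  (forall Y, f (dcos H (z^-1 * lrep Y)%g) != 0 -> B Y) ->
  hecke_act f F z = \sum_(Y \in B) f (dcos H (z^-1 * lrep Y)%g) *: F Y.
Proof.
move=> fB; rewrite /hecke_act -(fsbig_widen B)// => Y [_ /= BY].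
by have [->|/fB//] := eqVneq (f (dcos H (z^-1 * lrep Y)%g)) 0; rewrite scale0r.
Qed.

Lemma hecke_act_linearl U (F : X -> U) z a f g :
  hecke_act (a *: f + g) F z = a *: hecke_act f F z + hecke_act g F z.
Proof.
(* One finite index set that serves for f, g and their combination. *)
pose B := [set Y : X | f (dcos H (z^-1 * lrep Y)%g) != 0] `|`
          [set Y : X | g (dcos H (z^-1 * lrep Y)%g) != 0].
have fB : finite_set B by rewrite finite_setU; split; exact: hecke_kernel_finite.
rewrite !(@hecke_act_widen _ _ _ _ B).
- rewrite !fsbig_finite// scaler_sumr -big_split; apply: eq_bigr => Y _.
  by rewrite /= scalerA -scalerDl.
- by move=> Y gY; right.
- by move=> Y fY; left.
- move=> Y afgY; rewrite /B /=; apply/orP; apply: contraNT afgY; rewrite negb_or !negbK.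
  move=> /andP[/eqP fY /eqP gY].
  by rewrite -[X in X == _]/(a * f _ + g _) fY gY mulr0 addr0.
Qed.

Lemma hecke_act_plin U (V : lmodType C) (L : U -> V) f (F : X -> U) z : linear L ->
  L (hecke_act f F z) = hecke_act f (L \o F) z.
Proof.
move=> Ll; have fB := hecke_kernel_finite f z.
rewrite !(hecke_act_widen _ (B := [set Y : X | f (dcos H (z^-1 * lrep Y)%g) != 0]))//.
rewrite plin_fsum//; apply: eq_fsbigr => Y _; exact: plinZ.
Qed.

Lemma hecke_act_linearr U f z : linear (fun F : X -> U => hecke_act f F z).
Proof.
move=> a F F'; have fB := hecke_kernel_finite f z.
rewrite !(hecke_act_widen _ (B := [set Y : X | f (dcos H (z^-1 * lrep Y)%g) != 0]))//.
rewrite !fsbig_finite// scaler_sumr -big_split; apply: eq_bigr => Y _.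
by rewrite /= fctE scalerDr !scalerA mulrC.
Qed.

Lemma hecke_act_lcos U f (F : X -> U) z z' : lcos H z = lcos H z' ->
  hecke_act f F z = hecke_act f F z'.
Proof.
move=> zz'; rewrite /hecke_act; apply: eq_fsbigr => Y _.
by rewrite (dcos_mulVl _ zz').
Qed.

(** The substitution Y = zW passes from the matrix form to the form in which [rho] is defined. *)
Lemma hecke_act_shift U f (F : X -> U) z : hecke_act f F z =
  \sum_(W \in [set: X]) f (dcos H (lrep W)) *: F (lcos H (z * lrep W)%g).
Proof.
rewrite /hecke_act (@reindex_fsbigT _ _ _ X X (fun W => lcos H (z * lrep W)%g)) /=; last first.
  exists (fun Y => lcos H (z^-1 * lrep Y)%g) => Y.
    by rewrite (lcos_mull _ (lrepK _)) mulKg lrepK.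
  by rewrite (lcos_mull _ (lrepK _)) mulVKg lrepK.
by apply: eq_fsbigr => W _; rewrite dcos_lrepr mulKg.
Qed.

Lemma hecke_act_char U x (F : X -> U) z :
  hecke_act (hecke_char R H x) F z = \sum_(W \in cosets_in H x) F (lcos H (z * lrep W)%g).
Proof.
rewrite hecke_act_shift -(fsbig_widen (cosets_in H x))//.
  apply: eq_fsbigr => W; rewrite inE => /cosets_inP Wx.
  by rewrite hecke_charE Wx eqxx scale1r.
by move=> W [_ Wx] /=; case: eqP => [/cosets_inP/Wx//|_]; rewrite scale0r.
Qed.

Lemma hecke_act_delta U f z (y : X) (F : X -> U) :
  hecke_act f (fun Y => (Y == y)%:R *: F Y) z = f (dcos H (z^-1 * lrep y)%g) *: F y.
Proof.
rewrite /hecke_act -(fsbig_widen [set y])//.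
  by rewrite fsbig_set1 eqxx scale1r.
by move=> Y [_ /= /eqP/negbTE ->]; rewrite scale0r scaler0.
Qed.

Lemma dcos1P x : dcos H x = dcos H 1%g <-> x \in H.
Proof.
split=> [/esym/dcosP/dcoset_setP[h [k [Hh Hk ->]]]|Hx]; first by rewrite mulg1 gpredM.
by rewrite -[x]mulg1 dcos_mulHl.
Qed.

Lemma hecke_act1 U (F : X -> U) z : hecke_act (hecke_char R H 1%g) F z = F (lcos H z).
Proof.
rewrite /hecke_act -(fsbig_widen [set lcos H z])//.
  by rewrite fsbig_set1 hecke_charE dcos_lrepr mulVg eqxx scale1r.
move=> Y [_ Yz] /=; case: eqP => [/dcos1P/lcosP zY|_]; last by rewrite scale0r.
by case: Yz => /=; rewrite -(lrepK Y) -zY.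
Qed.

(** Convolution is the product of the matrices f(z^-1 Y) and g(z^-1 Y): by [mulE], a column of the
    product is [hecke_act f] applied to a column of g. *)
Lemma hecke_act_mul U f g (F : X -> U) z :
  hecke_act (hecke_mul hH f g) F z = hecke_act f (hecke_act g F \o (@lrep G H)) z.
Proof.
have mulE (Y : X) : hecke_mul hH f g (dcos H (z^-1 * lrep Y)%g) =
    hecke_act f (fun Y' => g (dcos H ((lrep Y')^-1 * lrep Y)%g) : C^o) z.
  rewrite hecke_mulE hecke_act_shift; apply: eq_fsbigr => W _.
  by rewrite dcos_lrepl invgM mulgA.
pose A := fset_set [set Y : X | f (dcos H (z^-1 * lrep Y)%g) != 0].
have fA (V : lmodType C) (F' : X -> V) :
    hecke_act f F' z = \sum_(Y <- A) f (dcos H (z^-1 * lrep Y)%g) *: F' Y.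
  rewrite (@hecke_act_widen _ _ _ _ [set Y : X | f (dcos H (z^-1 * lrep Y)%g) != 0])//.
  by rewrite fsbig_finite//; exact: hecke_kernel_finite.
(* All cosets reached in two steps from z; being finite, this set allows the exchange of the two
   sums. *)
pose B := \bigcup_(Y in [set` A]) [set Y' : X | g (dcos H ((lrep Y)^-1 * lrep Y')%g) != 0].
have fB : finite_set B.
  by apply: bigcup_finite => [|Y _]; [exact: finite_fset|exact: hecke_kernel_finite].
rewrite (@hecke_act_widen _ _ _ _ B); last first.
  move=> Y; rewrite mulE fA; apply: contraNP => nB; rewrite big_seq big1// => Y' Y'A.
  have [->|gY] := eqVneq (g (dcos H ((lrep Y')^-1 * lrep Y)%g)) 0; first by rewrite scaler0.
  by case: nB; exists Y'.
rewrite fA fsbig_finite//.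
under eq_bigr do rewrite mulE fA scaler_suml.
rewrite exchange_big /= big_seq [RHS]big_seq; apply: eq_bigr => Y YA.
rewrite (@hecke_act_widen _ _ _ _ B); last by move=> Y' gY'; exists Y.
rewrite fsbig_finite// scaler_sumr; apply: eq_bigr => Y' _.
by rewrite scalerA.
Qed.

Lemma rhoE f (l : ell2 R X) Z : rho hH f l Z = hecke_act f (l : X -> C^o) (lrep Z).
Proof. by rewrite hecke_act_shift. Qed.

End hecke_action.

(** * Matrix unit pairs and covariant pairs *)

Section matrix_units.
Variables (R : realType) (G : groupType) (H : groupClosed G).
Hypothesis hH : hecke_pair H.
Local Notation C := R[i].
Local Notation X := (lcosets H).
Variables (K : hilbertType C) (nu : c0 R X -> K -> K) (V : hecke R H -> K -> K).
Hypotheses (hnu : c0_rep nu) (hV : hecke_rep hH V).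
Implicit Types (x y z : G) (v w : K).

Local Notation eps x := (c0_eps R (lcos H x%g)).
Local Notation u := (upsilon nu V).

Lemma bounded_comp (K1 K2 K3 : hilbertType C) (A : K2 -> K3) (B : K1 -> K2) :
  bounded_op A -> bounded_op B -> bounded_op (A \o B).
Proof.
move=> [Al Ac] [Bl Bc]; split=> [a v w|v]; first by rewrite /= Bl Al.
by apply: continuous_comp; [exact: Bc|exact: Ac].
Qed.

Lemma bounded_upsilon x y : bounded_op (u x y).
Proof.
apply: (bounded_comp (c0_rep_bounded hnu _)).
apply: (bounded_comp (hecke_rep_bounded hV _)); exact: c0_rep_bounded.
Qed.

(** Replacing x by xh and y by yk turns x^-1 y into h^-1 x^-1 y k, which lies in the same double
    coset. *)
Lemma upsilon_lcos x x' y y' v : lcos H x = lcos H x' -> lcos H y = lcos H y' ->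
  u x y v = u x' y' v.
Proof.
move=> xx' yy'; rewrite /upsilon xx' yy' (@hecke_char_dcos R G H _ (x'^-1 * y')%g)//.
by rewrite -dcos_lrepl xx' dcos_lrepl (lcos_dcos (lcos_mull _ yy')).
Qed.

Lemma upsilonxx x v : u x x v = nu (eps x) v.
Proof. by rewrite /upsilon mulVg hecke_rep_unital// c0_rep_eps// eqxx scale1r. Qed.

Lemma upsilon_nul x y f v : nu f (u x y v) = f (lcos H x) *: u x y v.
Proof. exact: c0_rep_epsr. Qed.

Lemma upsilon_nur x y f v : u x y (nu f v) = f (lcos H y) *: u x y v.
Proof.
rewrite /upsilon c0_rep_epsl//.
have [Vl _] := hecke_rep_bounded hV (hecke_char R H (x^-1 * y)%g).
by rewrite (plinZ Vl) (plinZ (c0_rep_linearv hnu _)).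
Qed.

(** [s x] is u(1,x) read in [K0], and [J x] is its adjoint u(x,1). If every u(1,x) v vanishes, so
    does nu(eps_x) v = u(x,1) u(1,x) v, and [c0_rep_total] gives v = 0. *)
Lemma matrix_unit_slicing : matrix_unit_pair nu V ->
  exists (K0 : hilbertType C) (J : X -> K0 -> K) (s : X -> K -> K0),
    [/\ slicing J s, forall f (x : X) v, s x (nu f v) = f x *: s x v &
        forall (x : X) y z v, s x (u y z v) = (x == lcos H y)%:R *: s (lcos H z) v].
Proof.
move=> [uadj umul uort]; pose e := eps 1%g.
have [K0 [iota [iota_linear iota_inner iota_im]]] := fixed_spaceP (c0_rep_bounded hnu e).
have iota_inj a b : iota a = iota b -> a = b.
  by move=> ab; apply: inner_inj => c; rewrite -!iota_inner ab.
have uE x y z t v : u x y (u z t v) = (lcos H y == lcos H z)%:R *: u x t v.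
  case: eqP => [yz|/uort ->]; last by rewrite scale0r.
  by rewrite scale1r (upsilon_lcos _ (erefl (lcos H x)) yz) umul.
have /choice[s sE] (x : X) : exists s : K -> K0, forall v, iota (s v) = u 1%g (lrep x) v.
  have /choice[s0 s0E] v : exists k, iota k = u 1%g (lrep x) v.
    by apply/iota_im; rewrite upsilon_nul /= eqxx scale1r.
  by exists s0.
pose J (x : X) k := u (lrep x) 1%g (iota k).
have u1K k : nu e (iota k) = iota k by apply/iota_im; exists k.
exists K0, J, s; split; first split.
- by move=> x k v; rewrite [LHS]uadj -sE iota_inner.
- move=> x y k; apply: iota_inj.
  by rewrite sE uE !lrepK upsilonxx u1K (plinZ iota_linear).
- move=> v v0; apply: (c0_rep_total hnu) => x.
  rewrite -(lrepK x) -upsilonxx -(umul _ 1%g) -sE v0 (plin0 iota_linear).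
  by have [/plin0 -> _] := bounded_upsilon (lrep x) 1%g.
- move=> f x v; apply: iota_inj.
  by rewrite (plinZ iota_linear) !sE upsilon_nur lrepK.
- move=> x y z v; apply: iota_inj.
  rewrite (plinZ iota_linear) !sE uE lrepK; congr (_ *: _).
  by apply: upsilon_lcos; rewrite ?lrepK.
Qed.

(** With Y = xu and Z = xv one has u^-1 v = Y^-1 Z, so each summand of the covariance relation is a
    matrix unit candidate u(Y,Z). *)
Lemma covariant_kernel a x b v :
  \sum_(U \in cosets_in H a^-1%g) \sum_(W \in cosets_in H b)
    nu (eps (x * lrep U)) (V (hecke_char R H ((lrep U)^-1 * lrep W)%g)
      (nu (eps (x * lrep W)) v)) =
  hecke_act (hecke_char R H a^-1%g) (fun Y =>
    hecke_act (hecke_char R H b) (fun Z => u (lrep Y) (lrep Z) v) x) x.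
Proof.
rewrite hecke_act_char; apply: eq_fsbigr => U _.
rewrite hecke_act_char; apply: eq_fsbigr => W _.
by rewrite (upsilon_lcos _ (lrepK _) (lrepK _)) /upsilon invgM -mulgA mulKg.
Qed.

Hypothesis cov : covariant_pair nu V.

(** This is covariance with a = 1: V([H]) is the identity, and the left sum shrinks to the single
    coset Y = zH. *)
Lemma covariant_eps f z v :
  nu (eps z) (V f v) = hecke_act f (fun Y => u z (lrep Y) v) z.
Proof.
have nul := c0_rep_linearv hnu (eps z).
elim/hecke_ind: f => [|a f g IHf IHg|b].
- have -> : V 0 v = 0 by exact: (plin0 (fun a f g => hecke_rep_linear hV a f g v)).
  rewrite (plin0 nul); apply/esym.
  exact: (plin0 (fun a f g => hecke_act_linearl hH (fun Y => u z (lrep Y) v) z a f g)).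
- by rewrite (hecke_rep_linear hV) nul IHf IHg hecke_act_linearl.
have := cov 1%g z b v; rewrite (hecke_rep_unital hV) covariant_kernel invg1 hecke_act1 => ->.
rewrite /hecke_act; apply: eq_fsbigr => Y _; congr (_ *: _).
exact: (upsilon_lcos _ (lrepK _) erefl).
Qed.

Lemma covariant_matrix_unit : matrix_unit_pair nu V.
Proof.
have umul x y z v : u x y (u y z v) = u x z v.
  rewrite /upsilon [nu (eps y) (nu _ _)]c0_rep_eps// eqxx scale1r cov covariant_kernel.
  rewrite (hecke_act_plin hH); last exact: c0_rep_linearv.
  (* Covariance at the middle point y expands the product over all u(Y,Z); the outer nu(eps_x) and
     nu(eps_z) keep only Y = xH and Z = zH, whose coefficients are 1. *)
  transitivity (hecke_act (hecke_char R H (x^-1 * y)^-1%g) (fun Y => (Y == lcos H x)%:R *: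
      hecke_act (hecke_char R H (y^-1 * z)%g) (fun Z => (Z == lcos H z)%:R *:
        u (lrep Y) (lrep Z) v) y) y).
    congr (hecke_act _ _ _); apply/funext => Y.
    rewrite /= (hecke_act_plin hH); last exact: c0_rep_linearv.
    rewrite -(plinZ (hecke_act_linearr hH _ _)); congr (hecke_act _ _ _).
    by apply/funext => Z; rewrite /= upsilon_nul upsilon_nur /= !lrepK.
  rewrite hecke_act_delta hecke_act_delta !hecke_charE !dcos_lrepr invgM invgK !eqxx !scale1r.
  exact: (upsilon_lcos _ (lrepK _) (lrepK _)).
split=> // [x y v w|x y z t v yz].
  rewrite /upsilon (c0_rep_eps_adj hnu) (hecke_rep_star hV) hecke_star_char.
  by rewrite invgM invgK (c0_rep_eps_adj hnu).
rewrite {2}/upsilon upsilon_nur /=.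
by case: eqP => [/yz|_]; rewrite ?scale0r.
Qed.

End matrix_units.

(** * Tensor models *)

Section tensor_operators.
Variable R : realType.
Local Notation C := R[i].
Variables (K0 L T : hilbertType C) (t : hilbert_tensor K0 L T).

Lemma tensor_ext (W : normedModType C) (A B : T -> W) :
  linear A -> continuous A -> linear B -> continuous B ->
  (forall k l, A (t k l) = B (t k l)) -> A =1 B.
Proof.
move=> Al Ac Bl Bc AB; apply: (dense_ext (tens_dense t) Ac Bc) => v [r ->].
by rewrite !plin_sum//; apply: eq_bigr => p _.
Qed.

Lemma tensor_bounded_ext (W : hilbertType C) (A B : T -> W) :
  bounded_op A -> bounded_op B -> (forall k l, A (t k l) = B (t k l)) -> A =1 B.
Proof. by move=> [Al Ac] [Bl Bc]; exact: tensor_ext. Qed.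

Lemma tensor_is_adjoint (A B : T -> T) : bounded_op A -> bounded_op B ->
  (forall k l k' l', inner (A (t k l)) (t k' l') = inner (t k l) (B (t k' l'))) ->
  is_adjoint A B.
Proof.
move=> [Al Ac] [Bl Bc] AB.
have AB1 v k l : inner (A v) (t k l) = inner v (B (t k l)).
  apply: (@tensor_ext C^o (fun v => inner (A v) (t k l)) (fun v => inner v (B (t k l)))) => //.
  - by move=> a u w; rewrite Al inner_linearl.
  - by move=> u; exact: (cvg_comp _ _ (Ac u) (@inner_continuousl _ _ (t k l) (A u))).
  - exact: inner_linearl.
  - exact: inner_continuousl.
(* The inner product is conjugate-linear in its second variable, so both sides are conjugated before
   density is used a second time. *)
move=> v w; rewrite innerC [RHS]innerC; congr (_^*).
apply: (@tensor_ext C^o (fun w => inner w (A v)) (fun w => inner (B w) v)) => //.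
- exact: inner_linearl.
- exact: inner_continuousl.
- by move=> a u z; rewrite Bl inner_linearl.
- by move=> u; exact: (cvg_comp _ _ (Bc u) (@inner_continuousl _ _ v (B u))).
- by move=> k l; rewrite innerC AB1 -innerC.
Qed.

Lemma bounded_sum (K K' : hilbertType C) (I : choiceType) (D : set I) (A : I -> K -> K') :
  finite_set D -> (forall i, bounded_op (A i)) ->
  bounded_op (fun v => \sum_(i \in D) A i v).
Proof.
move=> fD Ab; rewrite (_ : (fun _ => _) = fun v => \sum_(i <- fset_set D) A i v); last first.
  by apply/funext => v; rewrite fsbig_finite.
elim: (enum_fset (fset_set D)) => [|i r [IHl IHc]].
  split=> [a u v|]; first by rewrite !big_nil scaler0 addr0.
  by under eq_fun do rewrite big_nil; exact: cst_continuous.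
have [Al Ac] := Ab i; under eq_fun do rewrite big_cons.
split=> [a u v|v]; first by rewrite /= IHl Al scalerDr addrACA.
by apply: (@cvgD C _ _ (nbhs v) _ (A i)); [exact: Ac|exact: IHc].
Qed.

End tensor_operators.

Lemma inner_ell2_eps (R : realType) (X : choiceType) (l : ell2 R X) (x : X) :
  inner l (ell2_eps R x) = l x.
Proof.
have FF : ProperFilter (@totally X) := totally_filter.
apply: ell2_dotP; apply: cvg_near_cst; exists [fset x]%fset => // A /= xA.
have {}xA : x \in A by rewrite (fsubsetP xA)// inE.
rewrite partial_sumE (big_fsetD1 x)//= eqxx conjC_nat mulr1 big_seq big1 ?addr0// => y.
by rewrite !inE => /andP[/negbTE -> _]; rewrite conjC_nat mulr0.
Qed.

Lemma mult_op_eps (R : realType) (X : choiceType) (x : X) (l : ell2 R X) :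
  mult_op (c0_eps R x) l = l x *: ell2_eps R x.
Proof.
apply: ell2_ext => y; rewrite -[RHS]/(l x * (y == x)%:R) /=.
by case: eqP => [->|_]; rewrite ?mulr0 ?mul0r// mulr1 mul1r.
Qed.

Section models.
Variables (R : realType) (G : groupType) (H : groupClosed G).
Hypothesis hH : hecke_pair H.
Local Notation C := R[i].
Local Notation X := (lcosets H).
Implicit Types (x y z : G).
Local Notation eps x := (c0_eps R (lcos H x%g)).
Local Notation dchar a := (hecke_char R H a%g).

Lemma rho_mult_eps f y (l : ell2 R X) z :
  rho hH f (mult_op (eps y) l) (lcos H z) = f (dcos H (z^-1 * y)%g) * l (lcos H y).
Proof.
rewrite rhoE (hecke_act_lcos _ _ (lrepK _)).
by have := hecke_act_delta f z (lcos H y) (l : X -> C^o); rewrite dcos_lrepr.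
Qed.

(** The corner of [rho] is the standard matrix unit of l^2(G/H), because the coefficient of
    rho([Hx^-1yH]) at (xH, yH) is 1. *)
Lemma rho_corner x y (l : ell2 R X) :
  mult_op (eps x) (rho hH (dchar (x^-1 * y)) (mult_op (eps y) l)) =
  l (lcos H y) *: ell2_eps R (lcos H x).
Proof. by rewrite mult_op_eps rho_mult_eps hecke_charE eqxx mul1r. Qed.

Lemma rhoZ f c (l : ell2 R X) : rho hH f (c *: l) = c *: rho hH f l.
Proof.
apply: ell2_ext => Z; rewrite -[RHS]/(c * rho hH f l Z) !rhoE.
exact: (plinZ (hecke_act_linearr hH f (lrep Z) (U := C^o))).
Qed.

(** By [rho_corner] the right side is the sum of l(xv) eps_xu over u and v. It factors into the sum
    of the eps_xu, which is rho([HaH]) eps_x, times the scalar (rho([HbH]) l)(xH). *)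
Lemma rho_covariant a x b (l : ell2 R X) :
  rho hH (dchar a) (mult_op (eps x) (rho hH (dchar b) l)) =
  \sum_(U \in cosets_in H a^-1%g) \sum_(W \in cosets_in H b)
    mult_op (eps (x * lrep U)) (rho hH (dchar ((lrep U)^-1 * lrep W))
        (mult_op (eps (x * lrep W)) l)).
Proof.
rewrite mult_op_eps rhoZ rho_eps fsbig_finite ?[RHS]fsbig_finite//; try exact: hH.
rewrite scaler_sumr; apply: eq_bigr => U _.
rewrite rhoE (hecke_act_lcos _ _ (lrepK _)) hecke_act_char.
rewrite !fsbig_finite; try exact: hH.
rewrite scaler_suml; apply: eq_bigr => W _.
by rewrite -rho_corner invgM -mulgA mulKg.
Qed.

Lemma isometry_inj (K L : hilbertType C) (U : K -> L) :
  (forall v w, inner (U v) (U w) = inner v w) -> injective U.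
Proof. by move=> Ui v w vw; apply: inner_inj => z; rewrite -!Ui vw. Qed.

Section equivalence.
Variables (K K' : hilbertType C) (nu : c0 R X -> K -> K) (V : hecke R H -> K -> K).
Variables (nu' : c0 R X -> K' -> K') (V' : hecke R H -> K' -> K').

Lemma matrix_unit_pair_equiv :
  pair_equiv nu V nu' V' -> matrix_unit_pair nu' V' -> matrix_unit_pair nu V.
Proof.
move=> [U [[Ul Ui _] Unu UV]] [uadj umul uort].
have Uu x y v : U (upsilon nu V x y v) = upsilon nu' V' x y (U v).
  by rewrite /upsilon Unu UV Unu.
split=> [x y v w|x y z v|x y z t v yz].
- by rewrite -!Ui !Uu uadj.
- by apply: (isometry_inj Ui); rewrite !Uu umul.
- by apply: (isometry_inj Ui); rewrite !Uu uort// (plin0 Ul).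
Qed.

Lemma covariant_pair_equiv :
  pair_equiv nu V nu' V' -> covariant_pair nu' V' -> covariant_pair nu V.
Proof.
move=> [U [[Ul Ui _] Unu UV]] cov a x b v; apply: (isometry_inj Ui).
rewrite UV Unu UV cov (plin_fsum Ul)//.
apply: eq_fsbigr => Y _; rewrite (plin_fsum Ul)//.
by apply: eq_fsbigr => W _; rewrite Unu UV Unu.
Qed.

End equivalence.

Section tensor_models.
Variables (K0 T : hilbertType C) (t : hilbert_tensor K0 (ell2 R X) T).
Variables (oneM : c0 R X -> T -> T).
Hypothesis oneMP : forall f, one_tensor_op t (mult_op f) (oneM f).

(** Of [V] only the corners are known on elementary tensors, and they send k (x) l to k (x) l(y)
    eps_x; density and boundedness extend the relations to all of [T]. *)
Lemma tensor_matrix_unit_pair (V : hecke R H -> T -> T) :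
  (forall x y, one_tensor_op t
     (mult_op (eps x) \o rho hH (dchar (x^-1 * y)) \o mult_op (eps y))
     (oneM (eps x) \o V (dchar (x^-1 * y)) \o oneM (eps y))) ->
  matrix_unit_pair oneM V.
Proof.
move=> VP.
have ub x y : bounded_op (upsilon oneM V x y) by case: (VP x y).
have uE x y k l : upsilon oneM V x y (t k l) = t k (l (lcos H y) *: ell2_eps R (lcos H x)).
  by have [_ uE] := VP x y; rewrite -rho_corner -[RHS]uE.
have uE2 x y w k c : upsilon oneM V x y (t k (c *: ell2_eps R (lcos H w))) =
    t k ((c * (lcos H y == lcos H w)%:R) *: ell2_eps R (lcos H x)) by exact: uE.
split=> [x y|x y z|x y w z v yw].
- apply: (tensor_is_adjoint (t := t)) => // k l k' l'; rewrite !uE !tens_inner innerZl innerZr.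
  congr (_ * _).
  by rewrite inner_ell2_eps innerC inner_ell2_eps mulrC.
- apply: (tensor_bounded_ext (t := t) (A := upsilon oneM V x y \o upsilon oneM V y z))
    => [||k l]; [exact: bounded_comp|by []|].
  by rewrite /= uE uE2 uE eqxx mulr1.
- apply: (tensor_bounded_ext (t := t) (A := upsilon oneM V x y \o upsilon oneM V w z)
    (B := fun=> 0)) => [||k l]; [exact: bounded_comp| |].
    by split=> [a u u'|]; [rewrite scaler0 addr0|exact: cst_continuous].
  rewrite /= uE uE2.
  by case: eqP => // _; rewrite mulr0 scale0r linear0r.
Qed.

Lemma tensor_covariant_pair (oneRho : hecke R H -> T -> T) :
  (forall f, one_tensor_op t (rho hH f) (oneRho f)) -> covariant_pair oneM oneRho.
Proof.
move=> oneRhoP a x b.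
have Mb f : bounded_op (oneM f) by case: (oneMP f).
have rb f : bounded_op (oneRho f) by case: (oneRhoP f).
have ME f k l : oneM f (t k l) = t k (mult_op f l) by case: (oneMP f).
have rE f k l : oneRho f (t k l) = t k (rho hH f l) by case: (oneRhoP f).
apply: (tensor_bounded_ext (t := t) (A := oneRho _ \o (oneM _ \o oneRho _))) => [||k l].
- by do 2!apply: bounded_comp => //.
- apply: bounded_sum => [|U]; first exact: hH.
  apply: bounded_sum => [|W]; first exact: hH.
  apply: (bounded_comp (A := oneM _) (B := oneRho _ \o oneM _)) => //; exact: bounded_comp.
rewrite /= rE ME rE rho_covariant.
have tl : linear (t k) by move=> c u v; rewrite linearPr.
rewrite (plin_fsum tl)//.
apply: eq_fsbigr => Y _; rewrite (plin_fsum tl)//.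
by apply: eq_fsbigr => W _; rewrite ME rE ME.
Qed.

End tensor_models.

Section slicing_models.
Variables (K0 K : hilbertType C) (J : X -> K0 -> K) (s : X -> K -> K0).
Hypothesis sl : slicing J s.
Variable nu : c0 R X -> K -> K.
Hypotheses (nu_bounded : forall f, bounded_op (nu f))
  (nu_slice : forall f (x : X) v, s x (nu f v) = f x *: s x v).
Variable t : hilbert_tensor K0 (ell2 R X) K.
Hypothesis slice_t : forall k l (x : X), s x (t k l) = l x *: k.

Lemma slicing_one_tensor (S : ell2 R X -> ell2 R X) (A : K -> K) : bounded_op A ->
  (forall k l (x : X), s x (A (t k l)) = S l x *: k) -> one_tensor_op t S A.
Proof.
by move=> Ab AS; split=> // k l; apply: (slice_ext sl) => x; rewrite AS slice_t.
Qed.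

Lemma slicing_one_tensor_mult f : one_tensor_op t (mult_op f) (nu f).
Proof.
by apply: slicing_one_tensor => // k l x; rewrite nu_slice slice_t scalerA.
Qed.

Lemma slicing_one_tensor_rho (V : hecke R H -> K -> K) f : bounded_op (V f) ->
  (forall (x : X) v, s x (V f v) = hecke_act f (s^~ v) (lrep x)) ->
  one_tensor_op t (rho hH f) (V f).
Proof.
move=> Vb Vs; apply: slicing_one_tensor => // k l x; rewrite Vs rhoE.
have kl : linear (fun c : C^o => c *: k) by move=> a c d; rewrite scalerDl scalerA.
rewrite (hecke_act_plin hH f _ _ kl); congr (hecke_act _ _ _).
by apply/funext => y; rewrite slice_t.
Qed.

Lemma slicing_one_tensor_corner x y (A : K -> K) : bounded_op A ->
  (forall (z : X) v, s z (A v) = (z == lcos H x)%:R *: s (lcos H y) v) ->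
  one_tensor_op t (mult_op (eps x) \o rho hH (dchar (x^-1 * y)) \o mult_op (eps y)) A.
Proof.
move=> Ab As; apply: slicing_one_tensor => // k l z.
rewrite As slice_t scalerA /comp rho_corner.
by rewrite -[in RHS]/(l (lcos H y) * (z == lcos H x)%:R) mulrC.
Qed.

End slicing_models.

Lemma pair_equiv_refl (K : hilbertType C) (nu : c0 R X -> K -> K) (V : hecke R H -> K -> K) :
  pair_equiv nu V nu V.
Proof. by exists id; split=> //; split=> // eta; exists eta. Qed.
End models.

(** * Recovering a slicing from an arbitrary model of a multiple of M *)

Lemma isometry_range_closed (R : realType) (K L : hilbertType R[i]) (J : K -> L) (w : L) :
  linear J -> (forall k, `|J k| = `|k|) ->
  (forall e, 0 < e -> exists k, `|w - J k| < e) -> exists k, J k = w.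
Proof.
move=> Jl Jn wJ.
(* The filter of approximate preimages of [w]: it is Cauchy because [J] preserves distances, and [J]
   sends its limit to [w]. *)
pose F := filter_from [set e : R[i] | 0 < e] (fun e => [set k | `|w - J k| < e]).
have FF : ProperFilter F.
  apply: filter_from_proper => [|e /wJ[k wk]]; last by exists k.
  apply: filter_from_filter; first by exists 1; rewrite /= ltr01.
  move=> d e /= d0 e0; have [de|ed] := real_leP (gtr0_real d0) (gtr0_real e0).
    by exists d => // k /= wk; split=> //; exact: lt_le_trans wk de.
  by exists e => // k /= wk; split=> //; exact: lt_trans wk ed.
have /cvg_ex[/= k Fk] : cvg F.
  apply: cauchy_cvg; apply/cauchy_exP => e e0.
  have e2 : 0 < e / 2 by rewrite divr_gt0.
  have [k0 wk0] := wJ _ e2; exists k0, (e / 2) => // k /= wk.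
  rewrite -ball_normE /= -Jn (plinB Jl) [e]splitr.
  by apply: le_lt_trans (ler_distD w _ _) _; rewrite distrC ltrD.
have Jc : continuous J.
  by apply: (lipschitz_continuous ler01 Jl) => v; rewrite mul1r Jn.
exists k; apply: (cvg_unique (@norm_hausdorff _ L) (F := J @ F) (cvg_comp _ _ Fk (Jc k))).
by apply/cvgrPdist_lt => e e0; exists e.
Qed.

Section tensor_corner.
Variables (R : realType) (X : choiceType) (K0 T : hilbertType R[i]).
Variables (t : hilbert_tensor K0 (ell2 R X) T) (oneM : c0 R X -> T -> T).
Hypothesis oneMP : forall f, one_tensor_op t (mult_op f) (oneM f).

Lemma tens_eps_linear x : linear (fun k => t k (ell2_eps R x)).
Proof. by move=> a u v; rewrite linearPl. Qed.

Lemma tens_eps_inner x k k' :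
  inner (t k (ell2_eps R x)) (t k' (ell2_eps R x)) = inner k k'.
Proof. by rewrite tens_inner inner_ell2_eps /= eqxx mulr1. Qed.

(** Since 1 (x) M(eps_x) sends k (x) l to l(x) k (x) eps_x, finite tensor sums near v give
    approximations of its image in the range of k |-> k (x) eps_x, which is closed. *)
Lemma oneM_eps_range x v : exists k, t k (ell2_eps R x) = oneM (c0_eps R x) v.
Proof.
have [[Ml Mc] MP] := oneMP (c0_eps R x).
apply: isometry_range_closed (tens_eps_linear x) _ _ => [k|e e0].
  by apply/eqP; rewrite -(eqrXn2 (n := 2))// -!innerxx tens_eps_inner.
have : nbhs v (fun w => `|oneM (c0_eps R x) v - oneM (c0_eps R x) w| < e).
  by move/cvgrPdist_lt: (Mc v); exact.
rewrite nbhsE => -[U [oU Uv] UP].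
have [w [/UP vw [r wE]]] := tens_dense t (ex_intro _ v Uv) oU.
exists (\sum_(p <- r) p.2 x *: p.1); rewrite (plin_sum (tens_eps_linear x)).
move: vw; rewrite {}wE (plin_sum Ml) => /le_lt_trans; apply; rewrite le_eqVlt; apply/orP; left.
apply/eqP; congr (`|_ - _|); apply: eq_bigr => p _.
by rewrite MP mult_op_eps linearZl_LR linearZr_LR.
Qed.

End tensor_corner.

Section equiv_slicing.
Variables (R : realType) (X : choiceType) (K0 K T : hilbertType R[i]).
Variables (t : hilbert_tensor K0 (ell2 R X) T) (oneM : c0 R X -> T -> T).
Hypothesis oneMP : forall f, one_tensor_op t (mult_op f) (oneM f).
Variable nu : c0 R X -> K -> K.
Hypothesis hnu : c0_rep nu.
Variable U : K -> T.
Hypotheses (UU : unitary U) (Unu : forall f v, U (nu f v) = oneM f (U v)).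

(** [J x] pulls k (x) eps_x back through [U], and [s x v] is the vector with s x v (x) eps_x = U
    nu(eps_x) v, supplied by [oneM_eps_range]. *)
Lemma equiv_slicing : exists (J : X -> K0 -> K) (s : X -> K -> K0),
  slicing J s /\ forall f x v, s x (nu f v) = f x *: s x v.
Proof.
have [Ul Ui Us] := UU; have /choice[U' UK] := Us.
have Uinj := isometry_inj Ui.
have tinj x : injective (fun k => t k (ell2_eps R x)).
  exact: isometry_inj (tens_eps_inner t x).
pose J x k := U' (t k (ell2_eps R x)).
have UJ x k : U (J x k) = t k (ell2_eps R x) by exact: UK.
have /choice[s sE] x : exists s : K -> K0, forall v,
    t (s v) (ell2_eps R x) = U (nu (c0_eps R x) v).
  have /choice[s0 s0E] v := oneM_eps_range oneMP x (U v).
  by exists s0 => v; rewrite s0E Unu.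
have nuJ x k : nu (c0_eps R x) (J x k) = J x k.
  apply: Uinj; rewrite Unu UJ; have [_ ->] := oneMP (c0_eps R x).
  by rewrite mult_op_eps /= eqxx scale1r.
have s_nu f x v : s x (nu f v) = f x *: s x v.
  apply: (tinj x); rewrite (plinZ (tens_eps_linear t x)) !sE.
  by rewrite (c0_rep_epsl hnu) (plinZ Ul).
exists J, s; split=> //; split=> [x k v|x y k|v v0].
- by rewrite -nuJ (c0_rep_eps_adj hnu) -Ui UJ -sE tens_eps_inner.
- rewrite -(nuJ y) s_nu /=; case: eqP => [->|_]; last by rewrite !scale0r.
  by rewrite !scale1r; apply: (tinj y); rewrite sE nuJ UJ.
- apply: (c0_rep_total hnu) => x; apply: Uinj.
  by rewrite -sE v0 (plin0 (tens_eps_linear t x)) (plin0 Ul).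
Qed.

End equiv_slicing.

(* [k] embeds every fibre of [phi] in [T]. *)
Lemma sum_comp_le (F : numDomainType) (X Y : choiceType) (phi : X -> X) (k : X -> Y)
    (T : {fset Y}) (g : X -> F) (M : F) :
  (forall x, 0 <= g x) -> (forall z, k z \in T) ->
  (forall z z', phi z = phi z' -> k z = k z' -> z = z') ->
  (forall B : {fset X}, \sum_(x <- B) g x <= M) ->
  forall A : {fset X}, \sum_(z <- A) g (phi z) <= M *+ size T.
Proof.
move=> g0 kT kI gM A.
have -> : \sum_(z <- A) g (phi z) = \sum_(y <- T) \sum_(z <- A | k z == y) g (phi z).
  rewrite (exchange_big_dep predT)//=; apply: eq_bigr => z _.
  rewrite -big_filter (_ : [seq y <- T | k z == y] = [:: k z]) ?big_seq1//.
  rewrite -(filter_pred1_uniq (fset_uniq T) (kT z)).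
  by apply: eq_filter => y; rewrite /= eq_sym.
have -> : M *+ size T = \sum_(y <- T) M by rewrite big_const_seq count_predT iter_addr_0.
apply: ler_sum => y _.
(* Where [k] takes the fixed value y, [phi] is injective, so the inner sum is a sum of [g] over a
   finite image set. *)
apply: le_trans (gM [fset phi z | z in [fset z in A | k z == y]]%fset).
rewrite [leRHS]big_imfset /=; first by rewrite big_fset_condE.
move=> z z'; rewrite !inE /= => /andP[_ /eqP kz] /andP[_ /eqP kz'] zz'.
by apply: kI => //; rewrite kz kz'.
Qed.

(** * The Hecke algebra representation carried by a slicing *)

Section hecke_slicing.
Variables (R : realType) (G : groupType) (H : groupClosed G).
Hypothesis hH : hecke_pair H.
Local Notation C := R[i].
Local Notation X := (lcosets H).
Variables (K0 K : hilbertType C) (J : X -> K0 -> K) (s : X -> K -> K0).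
Hypothesis sl : slicing J s.
Implicit Types (f g : hecke R H) (v w : K) (a z : G) (x : X).

(** If y is a representative of xaH, then y^-1 x lies in Ha^-1H. A fibre of the translation
    therefore has at most as many points as Ha^-1H has left cosets, which is where the Hecke
    condition enters. *)
Let translate_bound a v (A : {fset X}) :
  \sum_(x <- A) `|s (lcos H (lrep x * a)%g) v| ^+ 2 <=
  `|v| ^+ 2 *+ size (fset_set (cosets_in H a^-1%g)).
Proof.
apply: (sum_comp_le (phi := fun x => lcos H (lrep x * a)%g)
  (k := fun x => lcos H ((lrep (lcos H (lrep x * a)%g))^-1 * lrep x)%g)
  (g := fun y => `|s y v| ^+ 2)) => [y|z|z z' e|B].
- by rewrite exprn_ge0.
- rewrite in_fset_set ?inE; last exact: hH.
  by apply/cosets_inP; rewrite (lcos_dcos (lrepK _)) dcos_lrepl invgM mulgVK.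
- by move/(lcos_mull (lrep (lcos H (lrep z * a)%g))); rewrite {3}e !mulVKg !lrepK.
- exact: (slice_bessel sl).
Qed.

(** Right translation by [a] does not descend to G/H, so this operator depends on the chosen
    representatives; the combinations [hecke_op] do not. *)
Definition translate a v : K := of_slices s (fun x => s (lcos H (lrep x * a)%g) v).

Lemma slice_translate a v x : s x (translate a v) = s (lcos H (lrep x * a)%g) v.
Proof.
apply: (of_slicesK sl (k := fun x => s (lcos H (lrep x * a)%g) v)); eexists.
exact: translate_bound.
Qed.

Lemma bounded_translate a : bounded_op (translate a).
Proof.
have tl : linear (translate a).
  by move=> c u v; apply: (slice_ext sl) => x; rewrite !(slice_linear sl, slice_translate).
pose N : C := (size (fset_set (cosets_in H a^-1%g)))%:R.
have N0 : 0 <= sqrtC N by rewrite sqrtC_ge0 ler0n.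
split=> //; apply: (lipschitz_continuous N0 tl) => v.
apply: (slicing_norm_ler sl); first by rewrite mulr_ge0.
move=> A; rewrite exprMn sqrtCK mulrC mulr_natr.
by under eq_bigr do rewrite slice_translate.
Qed.

Definition hecke_op f v : K :=
  \sum_(W \in [set W : X | f (dcos H (lrep W)) != 0]) f (dcos H (lrep W)) *: translate (lrep W) v.

Lemma bounded_hecke_op f : bounded_op (hecke_op f).
Proof.
apply: bounded_sum => [|W]; first exact: hecke_supp_finite.
have [tl tc] := bounded_translate (lrep W).
split=> [a u v|v]; first by rewrite tl scalerDr !scalerA mulrC.
by apply: cvgZl_tmp; exact: tc.
Qed.

Lemma slice_hecke_op f v x : s x (hecke_op f v) = hecke_act f (s^~ v) (lrep x).
Proof.
have fS := hecke_supp_finite hH f; rewrite (plin_fsum (slice_linear sl x))//.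
rewrite hecke_act_shift -[RHS](fsbig_widen [set W : X | f (dcos H (lrep W)) != 0])//.
  by apply: eq_fsbigr => W _; rewrite (plinZ (slice_linear sl x)) slice_translate.
by move=> W [_ /= /negP/negPn/eqP ->]; rewrite scale0r.
Qed.

Lemma hecke_op_rep : hecke_rep hH hecke_op.
Proof.
have sl_lin x := slice_linear sl x.
split=> [|a f g v|f g v|f|v]; first exact: bounded_hecke_op.
- by apply: (slice_ext sl) => x; rewrite sl_lin !slice_hecke_op hecke_act_linearl.
- apply: (slice_ext sl) => x; rewrite !slice_hecke_op hecke_act_mul.
  by congr (hecke_act _ _ _); apply/funext => y; rewrite slice_hecke_op.
- move=> v w; have [fl fc] := bounded_hecke_op f.
  have [f'l f'c] := bounded_hecke_op (hecke_star f).
  (* For fixed v both sides are continuous and conjugate-linear in w, so it suffices to take w = J x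
     k. *)
  pose D := [set w | inner (hecke_op f v) w = inner v (hecke_op (hecke_star f) w)].
  have dD : dense D.
    apply: (slicing_dense sl) => [|a u u' Du Du'|x k]; rewrite /D /=.
    + by rewrite (plin0 f'l) !inner0r.
    + by rewrite f'l !innerDr !innerZr Du Du'.
    (* The support of row x of f. The matrix of [hecke_star f] has the conjugate of f(x^-1 Y) at (Y,
       x), so its column x has the same finite support. *)
    pose B := [set Y : X | f (dcos H ((lrep x)^-1 * lrep Y)%g) != 0].
    have fB : finite_set B by exact: hecke_kernel_finite.
    have -> : hecke_op (hecke_star f) (J x k) =
        \sum_(Y \in B) (f (dcos H ((lrep x)^-1 * lrep Y)%g))^* *: J Y k.
      apply: (slice_ext sl) => y; rewrite slice_hecke_op (plin_fsum (sl_lin y))//.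
      transitivity ((f (dcos H ((lrep x)^-1 * lrep y)%g))^* *: k).
        rewrite -[X in f (dcos H X)]invgK -hecke_starE invgM invgK.
        rewrite -(hecke_act_delta _ _ x (fun=> k)); congr (hecke_act _ _ _).
        by apply/funext => Y; rewrite (sliceJ sl).
      have sE Y : s y ((f (dcos H ((lrep x)^-1 * lrep Y)%g))^* *: J Y k) =
          (f (dcos H ((lrep x)^-1 * lrep Y)%g))^* *: ((y == Y)%:R *: k).
        by rewrite (plinZ (sl_lin y)) (sliceJ sl).
      under eq_fsbigr do rewrite sE.
      have [fy|fy] := eqVneq (f (dcos H ((lrep x)^-1 * lrep y)%g)) 0.
        rewrite fy conjC0 scale0r fsbig1// => Y _.
        by case: eqP => [<-|_]; rewrite ?fy ?conjC0 ?scale0r ?scaler0.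
      rewrite -[RHS](fsbig_widen [set y]).
      + by rewrite fsbig_set1 eqxx scale1r.
      + by move=> _ ->.
      + by move=> Y [_ /= /eqP]; rewrite eq_sym => /negbTE ->; rewrite scale0r scaler0.
    rewrite innerC (slice_adj sl) slice_hecke_op -innerC (hecke_act_widen _ (B := B))//.
    rewrite !fsbig_finite// inner_suml inner_sumr; apply: eq_bigr => Y _.
    by rewrite innerZl innerZr conjCK [inner v _]innerC (slice_adj sl) -innerC.
  have c1 := @inner_continuousr _ _ (hecke_op f v).
  have c2 : continuous (fun w => inner v (hecke_op (hecke_star f) w) : C^o).
    by move=> u; exact: (cvg_comp _ _ (f'c u) (@inner_continuousr _ _ v _)).
  exact: (dense_ext dD c1 c2 (fun _ Dw => Dw) w).
- by apply: (slice_ext sl) => x; rewrite slice_hecke_op hecke_act1 lrepK.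
Qed.

End hecke_slicing.

(** * The equivalences for a fixed representation of c_0(G/H) *)

Section main_results.
Variables (R : realType) (G : groupType) (H : groupClosed G).
Hypothesis hH : hecke_pair H.
Local Notation X := (lcosets H).
Variables (K : hilbertType R[i]) (nu : c0 R X -> K -> K).
Hypothesis hnu : c0_rep nu.

Lemma matrix_unit_pairP (V : hecke R H -> K -> K) : hecke_rep hH V ->
  (matrix_unit_pair nu V <->
    exists (K0 T : hilbertType R[i]) (t : hilbert_tensor K0 (ell2 R X) T)
           (oneM : c0 R X -> T -> T) (V' : hecke R H -> T -> T),
      [/\ forall f, one_tensor_op t (mult_op f) (oneM f),
          hecke_rep hH V',
          pair_equiv nu V oneM V'
        & forall x y : G,
            one_tensor_op t
              (mult_op (c0_eps R (lcos H x))
                \o rho hH (hecke_char R H (x^-1 * y)%g)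
                \o mult_op (c0_eps R (lcos H y)))
              (oneM (c0_eps R (lcos H x))
                \o V' (hecke_char R H (x^-1 * y)%g)
                \o oneM (c0_eps R (lcos H y)))]).
Proof.
move=> hV; split=> [mu|[K0 [T [t [oneM [V' [MP _ VV' corner]]]]]]]; last first.
  exact: matrix_unit_pair_equiv VV' (tensor_matrix_unit_pair corner).
have [K0 [J [s [sl s_nu s_u]]]] := matrix_unit_slicing hnu hV mu.
have [t st] := slicing_tensor sl.
exists K0, K, t, nu, V; split=> // [f||x y].
- exact: (slicing_one_tensor_mult sl (c0_rep_bounded hnu) s_nu st).
- exact: pair_equiv_refl.
- have ub := bounded_upsilon hnu hV x y.
  exact: (slicing_one_tensor_corner hH sl st ub (fun z => s_u z x y)).
Qed.

(** Only the action of [nu] and [V] on slices enters, so this serves both for a given covariant [V]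
    and for the constructed [hecke_op]. *)
Lemma slicing_covariant_model (K0 : hilbertType R[i]) (J : X -> K0 -> K) (s : X -> K -> K0)
    (V : hecke R H -> K -> K) :
  slicing J s -> (forall f (x : X) v, s x (nu f v) = f x *: s x v) ->
  (forall f, bounded_op (V f)) ->
  (forall f (x : X) v, s x (V f v) = hecke_act f (s^~ v) (lrep x)) ->
  exists (K0 T : hilbertType R[i]) (t : hilbert_tensor K0 (ell2 R X) T)
         (oneM : c0 R X -> T -> T) (oneRho : hecke R H -> T -> T),
    [/\ forall f, one_tensor_op t (mult_op f) (oneM f),
        forall f, one_tensor_op t (rho hH f) (oneRho f)
      & pair_equiv nu V oneM oneRho].
Proof.
move=> sl s_nu Vb s_V; have [t st] := slicing_tensor sl.
exists K0, K, t, nu, V; split=> [f|f|].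
- exact: (slicing_one_tensor_mult sl (c0_rep_bounded hnu) s_nu st).
- exact: (slicing_one_tensor_rho hH sl st (Vb f) (s_V f)).
- exact: pair_equiv_refl.
Qed.

Lemma covariant_pairP (V : hecke R H -> K -> K) : hecke_rep hH V ->
  (covariant_pair nu V <->
    exists (K0 T : hilbertType R[i]) (t : hilbert_tensor K0 (ell2 R X) T)
           (oneM : c0 R X -> T -> T) (oneRho : hecke R H -> T -> T),
      [/\ forall f, one_tensor_op t (mult_op f) (oneM f),
          forall f, one_tensor_op t (rho hH f) (oneRho f)
        & pair_equiv nu V oneM oneRho]).
Proof.
move=> hV; split=> [cov|[K0 [T [t [oneM [oneRho [MP rhoP VV']]]]]]]; last first.
  exact: covariant_pair_equiv VV' (tensor_covariant_pair MP rhoP).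
have [K0 [J [s [sl s_nu s_u]]]] :=
  matrix_unit_slicing hnu hV (covariant_matrix_unit hnu hV cov).
apply: (slicing_covariant_model sl s_nu (hecke_rep_bounded hV)) => f x v.
(* Inserting nu(eps_x) leaves slice x unchanged and makes the row formula [covariant_eps]
   applicable; [s x] then turns u(x,Y) v into slice Y of v. *)
have <- : s x (nu (c0_eps R x) (V f v)) = s x (V f v) by rewrite s_nu /= eqxx scale1r.
rewrite -[X in c0_eps R X]lrepK (covariant_eps hnu hV cov).
rewrite (hecke_act_plin hH f _ _ (slice_linear sl x)); congr (hecke_act _ _ _).
by apply/funext => y; rewrite /= s_u !lrepK eqxx scale1r.
Qed.

Lemma multipleP :
  (exists (K0 T : hilbertType R[i]) (t : hilbert_tensor K0 (ell2 R X) T)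
          (oneM : c0 R X -> T -> T),
     (forall f, one_tensor_op t (mult_op f) (oneM f)) /\ c0_equiv nu oneM) <->
  (exists V : hecke R H -> K -> K, hecke_rep hH V /\ covariant_pair nu V).
Proof.
split=> [[K0 [T [t [oneM [MP [U [UU Unu]]]]]]]|[V [hV]]].
  have [J [s [sl s_nu]]] := equiv_slicing MP hnu UU Unu.
  exists (hecke_op s); have hV := hecke_op_rep hH sl; split=> //.
  (* Covariance of [hecke_op] is not computed directly: its slices are those of 1 (x) rho, and the
     tensor model is covariant. *)
  apply/(covariant_pairP hV); apply: (slicing_covariant_model sl s_nu).
    exact: (hecke_rep_bounded hV).
  by move=> f x v; exact: (slice_hecke_op hH sl).
move=> /(covariant_pairP hV)[K0 [T [t [oneM [oneRho [MP _ [U [UU Unu _]]]]]]]].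
by exists K0, T, t, oneM; split=> //; exists U.
Qed.

End main_results.

Theorem theorem1p6 (R : realType) (G : groupType) (H : groupClosed G)
    (hH : hecke_pair H) (K : hilbertType R[i])
    (nu : c0 R (lcosets H) -> K -> K) (hnu : c0_rep nu) :
  (forall V : hecke R H -> K -> K, hecke_rep hH V ->
    (matrix_unit_pair nu V <->
      exists (K0 T : hilbertType R[i])
             (t : hilbert_tensor K0 (ell2 R (lcosets H)) T)
             (oneM : c0 R (lcosets H) -> T -> T) (V' : hecke R H -> T -> T),
        [/\ forall f, one_tensor_op t (mult_op f) (oneM f),
            hecke_rep hH V',
            pair_equiv nu V oneM V'
          & forall x y : G,
              one_tensor_op t
                (mult_op (c0_eps R (lcos H x))
                  \o rho hH (hecke_char R H (x^-1 * y)%g)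
                  \o mult_op (c0_eps R (lcos H y)))
                (oneM (c0_eps R (lcos H x))
                  \o V' (hecke_char R H (x^-1 * y)%g)
                  \o oneM (c0_eps R (lcos H y)))]) /\
    (covariant_pair nu V <->
      exists (K0 T : hilbertType R[i])
             (t : hilbert_tensor K0 (ell2 R (lcosets H)) T)
             (oneM : c0 R (lcosets H) -> T -> T) (oneRho : hecke R H -> T -> T),
        [/\ forall f, one_tensor_op t (mult_op f) (oneM f),
            forall f, one_tensor_op t (rho hH f) (oneRho f)
          & pair_equiv nu V oneM oneRho])) /\
  ((exists (K0 T : hilbertType R[i])
           (t : hilbert_tensor K0 (ell2 R (lcosets H)) T)
           (oneM : c0 R (lcosets H) -> T -> T),
      (forall f, one_tensor_op t (mult_op f) (oneM f)) /\ c0_equiv nu oneM) <->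
   (exists V : hecke R H -> K -> K, hecke_rep hH V /\ covariant_pair nu V)).

Proof.
split=> [V hV|]; last exact: (multipleP hH hnu).
split; [exact: (matrix_unit_pairP hnu hV)|exact: (covariant_pairP hnu hV)].
Qed.
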